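(* Let $V$ be a finite-dimensional real inner product space, let $R\leq\operatorname{O}(V)$ be a finite group generated by reflections, and let $R^+:=R\cap\operatorname{SO}(V)$ be its alternating subgroup. Let $n\in\mathbb N$ denote the largest entry in the Coxeter matrix corresponding to $R$. Then $$n\sin(\tfrac{\pi}{2n})\leq c_2(V/R^+)\leq2.$$ In particular, the lower bound $n\sin(\tfrac{\pi}{2n})$ is at least $\sqrt2$ when $|R|>2$, and at least $\tfrac32$ when $|R|>2$ and $R$ is also irreducible as a reflection group.
   Context: A reflection is an orthogonal transformation of $V$ that fixes a hyperplane (codimension $1$) pointwise and negates its normal line. Let $s_1,\ldots,s_m$ be the fundamental (simple) reflections of $R$ across the walls of a fixed Weyl chamber; the Coxeter matrix has $(i,j)$ entry equal to the order of $s_is_j$ (so diagonal entries are $1$). If $R$ is trivial, $n$ is read as $1$. If a group $G$ acts by isometries on a metric space $X$ with closed orbits, the orbit space $X/G$ carries the quotient metric $d([x],[y])=\inf_{p\in[x],\,q\in[y]}d_X(p,q)$, where $[x]=G\cdot x$. For a map $f\colon X\to Y$ of metric spaces, let $\alpha,\beta\in[0,\infty]$ be the largest and smallest constants (respectively) with $\alpha\, d_X(x,x')\le d_Y(f(x),f(x'))\le\beta\, d_X(x,x')$ for all $x,x'\in X$; the distortion of $f$ is $\kappa(f):=\beta/\alpha$, with $\kappa(f)=\infty$ if $\alpha=0$ or $\beta=\infty$. The Euclidean distortion $c_2(X)\in[1,\infty]$ is the infimum of all $c$ for which there exist a Hilbert space $H$ and a map $f\colon X\to H$ with $\kappa(f)=c$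 (a one-point space is a degenerate case, for which $c_2$ is taken to be $1$). *)

(* Defs.v *)
From HB Require Import structures.
From mathcomp Require Import all_boot all_order all_algebra finmap.
From mathcomp Require Import all_classical all_reals all_analysis.
Set Implicit Arguments.
Unset Strict Implicit.
Unset Printing Implicit Defensive.
Import Order.TTheory GRing.Theory Num.Theory.
Import numFieldNormedType.Exports.

Local Open Scope classical_set_scope.
Local Open Scope ring_scope.

Section ReflectionGroups.
Context {R : realType} {V : vectType R} (ip : {dot V for @idfun R}).

Definition ipdist (x y : V) : R := Num.sqrt (ip (x - y) (x - y)).

Definition orthogonal_maps : set 'End(V) :=
  [set g | forall x y, ip (g x) (g y) = ip x y].

Definition orthogonal_subgroup (G : set 'End(V)) :=
  [/\ G `<=` orthogonal_maps,
      G \1%VF,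
      forall g h, G g -> G h -> G (g \o h)%VF
    & forall g, G g -> G (g^-1)%VF].

Definition alternating_subgroup (W : set 'End(V)) : set 'End(V) :=
  [set g | W g /\ \det (passmx.mxof (vbasis {:V}) (vbasis {:V}) g) = 1].

Definition reflection (s : 'End(V)) :=
  orthogonal_maps s /\
  exists H : {vspace V},
    [/\ (\dim H).+1 = \dim {:V},
        forall x, x \in H -> s x = x
      & forall y, (forall x, x \in H -> ip x y = 0) -> s y = - y].

Definition generated_by_reflections (W : set 'End(V)) :=
  exists2 S : set 'End(V), S `<=` reflection &
    W = smallest orthogonal_subgroup S.

Definition finite_reflection_group (W : set 'End(V)) :=
  finite_set W /\ generated_by_reflections W.

(* W is not the internal direct product of two nontrivial subgroups
   generated by reflections. *)
Definition irreducible_reflection_group (W : set 'End(V)) :=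
  ~ exists W1 W2 : set 'End(V),
    [/\ generated_by_reflections W1 /\ W1 <> [set \1%VF],
        generated_by_reflections W2 /\ W2 <> [set \1%VF],
        forall g h, W1 g -> W2 h -> (g \o h = h \o g)%VF,
        W1 `&` W2 = [set \1%VF]
      & W = [set (g \o h)%VF | g in W1 & h in W2]].

(* For a reflection s, whose (-1)-eigenspace is the normal line of its mirror:
   x and y lie strictly on the same side of the mirror of s. *)
Definition same_side (s : 'End(V)) (x y : V) :=
  forall a, s a = - a -> a != 0 -> 0 < ip x a * ip y a.

(* The classes of points of the complement of the mirrors of W under the
   relation of not being separated by a mirror. *)
Definition weyl_chamber (W : set 'End(V)) (C : set V) :=
  exists2 x : V,
    forall s, W s -> reflection s -> x \notin fixedSpace s &
    C = [set y | forall s, W s -> reflection s -> same_side s x y].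

Definition ipclosure (C : set V) : set V :=
  [set z | forall e : R, 0 < e -> exists2 x, C x & ipdist x z < e].

(* The mirror of s is a wall of C when it meets the closure of C in a set with
   nonempty interior relative to the mirror. *)
Definition wall_reflection (C : set V) (s : 'End(V)) :=
  exists2 y, y \in fixedSpace s &
  exists2 e : R, 0 < e &
    forall z, z \in fixedSpace s -> ipdist z y < e -> ipclosure C z.

Definition fundamental_reflections (W : set 'End(V)) (C : set V) :
    set 'End(V) :=
  [set s | [/\ W s, reflection s & wall_reflection C s]].

Definition lfun_pow (g : 'End(V)) (k : nat) : 'End(V) :=
  iter k (comp_lfun g) \1%VF.

(* The value is 0 when g has infinite order. *)
Definition lfun_order (g : 'End(V)) : nat :=
  xget 0%N [set k | [/\ (0 < k)%N, lfun_pow g k = \1%VF &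
    forall j, (0 < j)%N -> lfun_pow g j = \1%VF -> (k <= j)%N]].

Definition fundamental_seq (W : set 'End(V)) (C : set V) : seq 'End(V) :=
  fset_set (fundamental_reflections W C).

Definition coxeter_matrix (W : set 'End(V)) (C : set V) :
    'M[nat]_(size (fundamental_seq W C)) :=
  let s := fundamental_seq W C in
  \matrix_(i, j) lfun_order (s`_i \o s`_j)%VF.

(* All entries are at least 1 when W is finite, so the default value 1 only
   matters for the empty matrix, that is, when W is trivial. *)
Definition max_coxeter_entry (W : set 'End(V)) (C : set V) : nat :=
  \big[maxn/1%N]_i \big[maxn/1%N]_j coxeter_matrix W C i j.

Definition group_orbit (G : set 'End(V)) (x : V) : set V :=
  [set g x | g in G].

Definition orbit_space (G : set 'End(V)) := {A : set V | range (group_orbit G) A}.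

Definition orbit_dist (G : set 'End(V)) (A B : orbit_space G) : R :=
  inf [set ipdist p q | p in sval A & q in sval B].

End ReflectionGroups.

Section Distortion.
Context {R : realType}.
Local Open Scope ereal_scope.

Definition lower_lipschitz {X Y : Type} (dX : X -> X -> R) (dY : Y -> Y -> R)
    (f : X -> Y) : \bar R :=
  ereal_sup [set a | 0 <= a /\
    forall x x', a * (dX x x')%:E <= (dY (f x) (f x'))%:E].

Definition upper_lipschitz {X Y : Type} (dX : X -> X -> R) (dY : Y -> Y -> R)
    (f : X -> Y) : \bar R :=
  ereal_inf [set b | 0 <= b /\
    forall x x', (dY (f x) (f x'))%:E <= b * (dX x x')%:E].

Definition distortion {X Y : Type} (dX : X -> X -> R) (dY : Y -> Y -> R)
    (f : X -> Y) : \bar R :=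
  let alpha := lower_lipschitz dX dY f in
  let beta := upper_lipschitz dX dY f in
  if (alpha == 0) || (beta == +oo) then +oo else beta / alpha.

(* A real Hilbert space is a complete normed module whose norm comes from an
   inner product. *)
Definition euclidean_distortion {X : Type} (dX : X -> X -> R) : \bar R :=
  if `[< forall x y : X, x = y >] then 1 else
  ereal_inf [set c | exists (H : completeNormedModType R)
                            (ipH : {dot H for @idfun R}),
    (forall u, ipH u u = (`|u| ^+ 2)%R) /\
    exists f : X -> H, c = distortion dX (fun u v : H => `|u - v|%R) f].

End Distortion.

(* Main.v *)
(* Lower bound.  Near a generic point fixed by two fundamental reflections whose
   product has order n, the quotient contains a circle around a cone of angle
   2 pi / N with N >= n.  Sampling that circle at 2 k points, the sharp Poincaré
   inequality for the 2 k-cycle in a Hilbert space bounds the distortion below by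
   sin (pi / (2 k)) sin (pi / (2 N)) / sin (pi / (2 N k)), which tends to
   N sin (pi / (2 N)) >= n sin (pi / (2 n)) as k grows.

   Upper bound.  An orbit of W^+ is represented by a pair (x, e) with x in the
   closed Weyl chamber and e = 1 or -1.  Let d x be the distance from x to the
   mirrors.  The map (x, e) |-> (x, e * d x) changes squared distances by a factor
   between 1 / 2 and 2: a segment joining the two sheets crosses a mirror, and
   conversely a nearest mirror provides a short path. *)

Require Import Defs.
From HB Require Import structures.
From mathcomp Require Import all_boot all_order all_algebra finmap.
From mathcomp Require Import all_classical all_reals all_analysis.
From mathcomp Require Import ring lra zify.
Import Order.TTheory GRing.Theory Num.Theory.
Import numFieldNormedType.Exports.

Set Implicit Arguments.
Unset Strict Implicit.
Unset Printing Implicit Defensive.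

Local Open Scope classical_set_scope.
Local Open Scope ring_scope.

(** * The Poincaré inequality on a cycle in an inner product space *)

(** The upper bound is 2 because squared distances change by a factor at most 2 either way, so the
    Lipschitz constants are 1 / sqrt 2 and sqrt 2. Two facts about the chamber carry it: for
    dominant x and y no g y is closer to x than y is, and only the identity keeps a point of the
    open chamber inside it. The second fact forces a segment between the sheets to meet a mirror. It
    is proved by deletion in words of wall reflections, where a wall is certified by a point lying
    on one mirror and strictly inside the half-spaces of all others. The cone angle is 2 pi / N with
    N possibly above n: N comes from the smallest rotation of W in the plane of the two normals, and
    the product of the two reflections is a power of it. Since n * sin (pi / (2 * n)) increases with
    n, N >= n suffices, and sqrt 2 and 3 / 2 are its values at n = 2 and n = 3. Two walls already
    give an entry above 1; if no entry exceeded 2, the wall reflections would commute and one of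
    them would split off from W, against irreducibility. *)

Section DotProduct.
Context {R : realType} {U : lmodType R} (ip : {dot U for @idfun R}).
Implicit Types x y z : U.

Lemma ipC x y : ip x y = ip y x.
Proof. by have := @hermC R false idfun U ip x y; rewrite expr0 mul1r. Qed.

Lemma ipDr z x y : ip z (x + y) = ip z x + ip z y.
Proof. exact: linearDr. Qed.

Lemma ipDl z x y : ip (x + y) z = ip x z + ip y z.
Proof. by rewrite ipC ipDr !(ipC z). Qed.

Lemma ipZr z a x : ip z (a *: x) = a * ip z x.
Proof. by rewrite linearZr_LR. Qed.

Lemma ipZl z a x : ip (a *: x) z = a * ip x z.
Proof. by rewrite ipC ipZr ipC. Qed.

Lemma ipNr z x : ip z (- x) = - ip z x.
Proof. exact: linearNr. Qed.

Lemma ipNl z x : ip (- x) z = - ip x z.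
Proof. by rewrite ipC ipNr ipC. Qed.

Lemma ip0r z : ip z 0 = 0.
Proof. exact: linear0r. Qed.

Lemma ip0l z : ip 0 z = 0.
Proof. by rewrite ipC ip0r. Qed.

Lemma ip_sumr z I (r : seq I) (P : pred I) (F : I -> U) :
  ip z (\sum_(i <- r | P i) F i) = \sum_(i <- r | P i) ip z (F i).
Proof. exact: linear_sumr. Qed.

Definition ipE := (ipDl, ipDr, ipNl, ipNr, ipZl, ipZr, ip0l, ip0r).

Lemma ip_gt0 x : x != 0 -> 0 < ip x x.
Proof. exact: neq0_dnorm_gt0. Qed.

Lemma ip_ge0 x : 0 <= ip x x.
Proof.
by have [->|/ip_gt0/ltW//] := eqVneq x 0; rewrite ip0l.
Qed.

Lemma ip_eq0 x : (ip x x == 0) = (x == 0).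
Proof.
apply/idP/eqP => [|->]; last by rewrite ip0l.
by apply: contraTeq => /ip_gt0 /lt0r_neq0.
Qed.

Lemma cauchy_schwarz x y : ip x y ^+ 2 <= ip x x * ip y y.
Proof.
have [->|/ip_gt0 y0] := eqVneq y 0; first by rewrite !ipE expr0n mulr0.
have := ip_ge0 (ip y y *: x - ip x y *: y).
rewrite !ipE (ipC y x) => h.
rewrite -subr_ge0 -(pmulr_rge0 _ y0); lra.
Qed.

Lemma ip_inj x y : (forall z, ip x z = ip y z) -> x = y.
Proof.
move=> h; apply/eqP; rewrite -subr_eq0 -ip_eq0 ipDl ipNl h.
by rewrite subrr.
Qed.

End DotProduct.

Section CycleInequality.
Context {R : realType} {U : lmodType R} (ip : {dot U for @idfun R}).

Lemma sum_periodic (f : nat -> R) (n d : nat) :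
  (forall j, f (j + n)%N = f j) ->
  \sum_(j < n) f (j + d)%N = \sum_(j < n) f j.
Proof.
move=> fn; elim: d => [|d <-]; first by under eq_bigr do rewrite addn0.
case: n fn => [|n] fn; first by rewrite !big_ord0.
rewrite big_ord_recr big_ord_recl /= addrC; congr (_ + _).
  by rewrite (_ : (n + d.+1 = 0 + d + n.+1)%N) ?fn//; lia.
by apply: eq_bigr => i _; congr f; rewrite /bump; lia.
Qed.

Lemma cauchy_schwarz_sum n (u v : 'I_n -> U) :
  (\sum_i ip (u i) (v i)) ^+ 2 <=
  (\sum_i ip (u i) (u i)) * (\sum_i ip (v i) (v i)).
Proof.
set A := \sum_i ip (u i) (v i); set B := \sum_i ip (u i) (u i).
set C := \sum_i ip (v i) (v i).
have quad (s t : R) : 0 <= s ^+ 2 * B - 2 * s * t * A + t ^+ 2 * C.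
  rewrite /A /B /C !mulr_sumr -sumrB -big_split /=; apply: sumr_ge0 => i _.
  have := ip_ge0 ip (s *: u i - t *: v i); rewrite !ipE.
  by rewrite (ipC ip (v i) (u i)) => h; lra.
have B0 : 0 <= B by apply: sumr_ge0 => i _; exact: ip_ge0.
have [B00|Bn0] := eqVneq B 0; last first.
  have Bp : 0 < B by rewrite lt_def Bn0.
  have := quad A B; rewrite -subr_ge0 -(pmulr_rge0 _ Bp) => h. lra.
(* If B = 0, the form at (C + 1, A) is - (C + 2) * A ^ 2, which forces A = 0. *)
rewrite B00 mul0r; have := quad (C + 1) A; rewrite B00.
have C0 : 0 <= C by apply: sumr_ge0 => i _; exact: ip_ge0.
have A2 := sqr_ge0 A; have := mulr_ge0 C0 A2 => CA q; lra.
Qed.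

Variables (r : nat) (y : nat -> U).
Local Notation k := (2 ^ r)%N.
Hypothesis yk : forall j, y (j + k)%N = - y j.

Let C d := \sum_(j < 2 * k) ip (y j) (y (j + d)%N).

Let shift d e : \sum_(j < 2 * k) ip (y (j + e)%N) (y (j + e + d)%N) = C d.
Proof.
apply: (@sum_periodic (fun j => ip (y j) (y (j + d)%N))) => j.
have y2k i : y (i + 2 * k)%N = y i by rewrite mul2n -addnn addnA !yk opprK.
by rewrite y2k addnAC y2k.
Qed.

(** A shift by d, a quarter of the period, turns the pair (y j, y (j + d)) into (y (j + d), - y
    j). *)
Let C_half d : (2 * d = k)%N -> C d = 0.
Proof.
move=> dk; suff : C d = - C d by lra.
rewrite -{1}(shift d d) /C -sumrN; apply: eq_bigr => j _.
by rewrite -addnA addnn -mul2n dk yk ipNr ipC.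
Qed.

(** Cauchy-Schwarz for y (j + d) against y j + y (j + 2 * d), whose inner products sum to 2 * C
    d. *)
Let C_double d : 4 * C d ^+ 2 <= C 0%N * (2 * C 0%N + 2 * C (2 * d)%N).
Proof.
have -> : 4 * C d ^+ 2 =
    (\sum_(j < 2 * k) ip (y (j + d)%N) (y j + y (j + 2 * d)%N)) ^+ 2.
  rewrite (_ : \sum_(j < _) _ = 2 * C d); first by rewrite exprMn; lra.
  transitivity (\sum_(j < 2 * k) (ip (y j) (y (j + d)%N) +
      ip (y (j + d)%N) (y (j + d + d)%N))).
    by apply: eq_bigr => j _; rewrite ipDr ipC (mul2n d) -addnn addnA.
  by rewrite big_split /= shift -/(C d); lra.
apply: le_trans (cauchy_schwarz_sum _ _) _.
rewrite le_eqVlt; apply/orP; left; apply/eqP; congr (_ * _).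
  by rewrite -(shift 0%N d); apply: eq_bigr => j _; rewrite addn0.
under eq_bigr => j _ do rewrite ipDr !ipDl (ipC ip (y (j + 2 * d)%N) (y j)).
rewrite !big_split /=.
rewrite (_ : \sum_(i < _) ip (y i) (y i) = C 0%N); last first.
  by apply: eq_bigr => j _; rewrite addn0.
rewrite (_ : \sum_(i < _) ip (y (i + _)%N) (y (i + _)%N) = C 0%N); last first.
  by rewrite -(shift 0%N (2 * d)%N); apply: eq_bigr => j _; rewrite addn0.
rewrite -/(C (2 * d)); lra.
Qed.

Let C0_ge0 : 0 <= C 0%N.
Proof. by apply: sumr_ge0 => j _; rewrite addn0 ip_ge0. Qed.

(** Each step halves both the lag d and the angle, starting from [C_half] at the angle pi / 2. *)
Let C_le m d : (d * 2 ^ m.+1 = k)%N -> C d <= cos (pi / 2 ^+ m.+1) * C 0%N.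
Proof.
elim: m d => [|m IH] d dk; first by rewrite expr1 cos_pihalf mul0r C_half// -dk mulnC.
have {}IH : C (2 * d)%N <= cos (pi / 2 ^+ m.+1) * C 0%N.
  by apply: IH; rewrite -dk (expnS 2 m.+1) [RHS]mulnCA mulnA.
set t := pi / 2 ^+ m.+2.
have tE : pi / 2 ^+ m.+1 = t *+ 2 :> R.
  rewrite /t [in RHS]exprS mulr2n; field.
  by rewrite expf_neq0.
have t0 : 0 <= t <= pi / 2.
  rewrite divr_ge0 ?pi_ge0 ?exprn_ge0// /t ler_wpM2l ?pi_ge0//.
  by rewrite lef_pV2 ?posrE ?exprn_gt0// exprS ler_peMr// exprn_ege1// ler1n.
have ct : 0 <= cos t by apply: cos_ge0_pihalf; have := pi_ge0 R => ?; lra.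
move: IH; rewrite tE cos_mulr2n => IH.
have := C_double d; have := C0_ge0; move: IH.
move: (C 0%N) (C (2 * d)%N) (C d) (cos t) ct => S C2 Cd c c0 C2le S0 C4.
have cS : 0 <= c * S by exact: mulr_ge0.
rewrite leNgt; apply/negP => lt; have : (c * S) ^+ 2 < Cd ^+ 2.
  by rewrite ltr_pXn2r// nnegrE; lra.
have : S * C2 <= S * ((c ^+ 2 *+ 2 - 1) * S) by rewrite ler_wpM2l.
rewrite -mulr_natr => ?; lra.
Qed.

(** The right-hand side is 2 * C 0 - 2 * C 1, so the bound on C 1 is the whole content. The constant
    is the lowest eigenvalue of the cycle Laplacian on antiperiodic sequences. *)
Lemma antiperiodic_wirtinger : (0 < r)%N ->
  2 * (1 - cos (pi / 2 ^+ r)) * \sum_(j < 2 * k) ip (y j) (y j) <=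
  \sum_(j < 2 * k) ip (y j - y j.+1) (y j - y j.+1).
Proof.
move=> r0; have := @C_le r.-1 1%N; rewrite prednK// mul1n => /(_ erefl) C1.
have S0 e : \sum_(j < 2 * k) ip (y (j + e)%N) (y (j + e)%N) = C 0%N.
  by rewrite -(shift 0%N e); apply: eq_bigr => j _; rewrite addn0.
have -> : \sum_(j < 2 * k) ip (y j) (y j) = C 0%N.
  by rewrite -(S0 0%N); apply: eq_bigr => j _; rewrite addn0.
have -> : \sum_(j < 2 * k) ip (y j - y j.+1) (y j - y j.+1) =
    2 * C 0%N - 2 * C 1%N.
  transitivity (\sum_(j < 2 * k) (ip (y (j + 0)%N) (y (j + 0)%N) +
      ip (y (j + 1)%N) (y (j + 1)%N) - 2 * ip (y j) (y (j + 1)%N))).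
    apply: eq_bigr => j _; rewrite (addn0 j) (addn1 j) !ipE.
    by rewrite (ipC ip (y j.+1) (y j)); lra.
  by rewrite sumrB big_split /= -mulr_sumr !S0 -/(C 1%N); lra.
lra.
Qed.

End CycleInequality.

(* The differences [x j - x (j + 2 ^ r)] are antiperiodic.  For an antiperiodic
   sequence with autocorrelations [C d], Cauchy-Schwarz gives
   [C d <= C 0 * sqrt ((1 + C (2 * d) / C 0) / 2)], which is the half-angle
   formula for the cosine, and [C (2 ^ r / 2) = 0]; this replaces Fourier
   analysis on the cycle. *)
Lemma cycle_inequality {R : realType} {U : lmodType R}
    (ip : {dot U for @idfun R}) (r : nat) (x : nat -> U) :
    (0 < r)%N -> (forall j, x (j + 2 * 2 ^ r)%N = x j) ->
  (1 - cos (pi / 2 ^+ r)) *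
    \sum_(j < 2 * 2 ^ r) ip (x j - x (j + 2 ^ r)%N) (x j - x (j + 2 ^ r)%N) <=
  2 * \sum_(j < 2 * 2 ^ r) ip (x j - x j.+1) (x j - x j.+1).
Proof.
move=> r0 x2k; set k := (2 ^ r)%N.
have := @antiperiodic_wirtinger R U ip r (fun j => x j - x (j + k)%N) _ r0.
move=> /(_ _)/wrap[j|]; first by rewrite -addnA addnn -mul2n x2k opprB.
set S := \sum_(j < _) _; set T := \sum_(j < _) _ => ST.
(* A step of the antiperiodic sequence is u - v for two edges u, v of the cycle that are k apart;
   its squared norm is at most 2 |u|^2 + 2 |v|^2, and both edges run over the whole cycle. *)
suff : T <= 4 * \sum_(j < 2 * k) ip (x j - x j.+1) (x j - x j.+1) by lra.
have -> : 4 * \sum_(j < 2 * k) ip (x j - x j.+1) (x j - x j.+1) =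
    \sum_(j < 2 * k) (2 * ip (x j - x j.+1) (x j - x j.+1) +
    2 * ip (x (j + k)%N - x (j + k).+1) (x (j + k)%N - x (j + k).+1)).
  rewrite big_split /= -!mulr_sumr.
  rewrite (@sum_periodic _ (fun j => ip (x j - x j.+1) (x j - x j.+1))); first lra.
  by move=> j; rewrite -addSn !x2k.
apply: ler_sum => j _; rewrite addSn.
have key (u v : U) : ip (u - v) (u - v) <= 2 * ip u u + 2 * ip v v.
  have := ip_ge0 ip (u + v); rewrite !ipE (ipC ip v u) => ?; lra.
apply: le_trans (key _ _).
by rewrite !opprB addrACA [X in _ + X]addrC addrACA [X in X + _]addrC addrC.
Qed.

(** * Distortion *)

Section Trigonometry.
Context {R : realType}.
Implicit Types a b t : R.

Lemma sin_mvt a b : a < b ->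
  exists2 c, a < c < b & sin b - sin a = cos c * (b - a).
Proof.
move=> ab; have [|c] := @MVT R sin cos a b ab (fun x _ => is_derive_sin x).
  exact/continuous_subspaceT/continuous_sin.
by rewrite in_itv /= => cab eq; exists c.
Qed.

Lemma sin_le_id t : 0 <= t -> sin t <= t.
Proof.
rewrite le_eqVlt => /predU1P[<-|t0]; first by rewrite sin0.
have [c _] := sin_mvt t0; rewrite sin0 !subr0 => ->.
by rewrite ler_piMl ?cos_le1 ?ltW.
Qed.

Lemma sin_ge_cos t : 0 <= t <= pi -> t * cos t <= sin t.
Proof.
move=> /andP[]; rewrite le_eqVlt => /predU1P[<-|t0 tpi].
  by rewrite sin0 mul0r.
have [c /andP[c0 ct]] := sin_mvt t0; rewrite sin0 !subr0 => ->.
rewrite mulrC ler_pM2r// ltW// ltr_cos ?in_itv/= ?tpi ?ltW//.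
by rewrite (lt_le_trans ct).
Qed.

(** With s = t / 2: cos t = 1 - 2 sin(s)^2 >= 1 - 2 s^2 >= 1 - 2 s. *)
Lemma cos_ge_1B t : 0 <= t <= 1 -> 1 - t <= cos t.
Proof.
move=> /andP[t0 t1]; have -> : t = (t / 2) *+ 2 by rewrite -mulr_natr; lra.
set s := t / 2; have s01 : 0 <= s <= 1 by rewrite /s; lra.
rewrite cos_mulr2n cos2sin2.
have ss : sin s <= s by apply: sin_le_id; lra.
have s0 : 0 <= sin s by apply: sin_ge0_pi; have := pi_ge2 R; lra.
have s2 : sin s ^+ 2 <= s ^+ 2 by rewrite ler_pXn2r// nnegrE; lra.
have ss2 : s ^+ 2 <= s by rewrite expr2 ler_piMl; lra.
rewrite !mulr2n; lra.
Qed.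

(** The mean slope of sin on [0, a] is cos c, on [a, b] it is cos d, and c < a < d. *)
Lemma sinc_le a b : 0 < a <= b -> b <= pi -> sin b * a <= sin a * b.
Proof.
move=> /andP[a0]; rewrite le_eqVlt => /predU1P[<-//|ab bpi].
have [c /andP[c0 ca]] := sin_mvt a0; rewrite sin0 !subr0 => sa.
have [d /andP[ad db] sb] := sin_mvt ab.
have dc : cos d <= cos c.
  by rewrite ltW// ltr_cos ?in_itv/=; lra.
have -> : sin b = cos c * a + cos d * (b - a) by rewrite -sb -sa; ring.
rewrite sa; have : 0 <= (cos c - cos d) * (a * (b - a)).
  by rewrite mulr_ge0 ?mulr_ge0; lra.
move=> ?; lra.
Qed.

(** Serves twice: to pass from the cone order N down to n, and from n down to 2 or 3 in the
    numerical bounds. *)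
Lemma mulr_sin_pi_le (n N : nat) : (0 < n <= N)%N ->
  n%:R * sin (pi / (2 * n%:R)) <= N%:R * sin (pi / (2 * N%:R)) :> R.
Proof.
move=> /andP[n0 nN]; have n0' : (0 : R) < n%:R by rewrite ltr0n.
have N0' : (0 : R) < N%:R by rewrite ltr0n (leq_trans n0).
have nN' : n%:R <= N%:R :> R by rewrite ler_nat.
have p0 := pi_gt0 R.
have h : sin (pi / (2 * n%:R)) * (pi / (2 * N%:R)) <=
    sin (pi / (2 * N%:R)) * (pi / (2 * n%:R)) :> R.
  apply: sinc_le.
    rewrite divr_gt0 ?mulr_gt0//= ler_pM2l// lef_pV2 ?posrE ?mulr_gt0//.
    by rewrite ler_pM2l.
  have n1 : 1 <= n%:R :> R by rewrite ler1n.
  by rewrite ler_pdivrMr ?mulr_gt0// ler_peMr ?ltW//; lra.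
have pn : 0 < 2 * N%:R * n%:R / (pi : R) by rewrite divr_gt0 ?mulr_gt0.
have n0n := lt0r_neq0 n0'; have N0n := lt0r_neq0 N0'; have p0n := lt0r_neq0 p0.
rewrite -(ler_pM2r pn) in h.
apply: etrans h; congr (_ <= _);
  by move: (sin _) => s; move: pi p0n => p p0n; field; rewrite p0n ?n0n ?N0n.
Qed.

(** cos (pi / 6) = sin (pi / 3) = 2 sin (pi / 6) cos (pi / 6), and the cosine is positive. *)
Lemma sin_pi6 : sin (pi / 6) = 1 / 2 :> R.
Proof.
have p0 := pi_gt0 R.
have c0 : 0 < cos (pi / 6 : R) by apply: cos_gt0_pihalf; lra.
have : cos (pi / 6 : R) = sin ((pi / 6) *+ 2).
  rewrite -cosBpihalf -[RHS]cosN; congr cos; rewrite mulr2n. by move: pi => p; field.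
rewrite sin_mulr2n mulr2n; move: (cos _) c0 (sin _) => c c0 s e.
have {}e : c * (1 - 2 * s) = 0 by lra.
by move/eqP: e; rewrite mulf_eq0 gt_eqF//= => /eqP ?; lra.
Qed.

Lemma sin_pi4 : 2 * sin (pi / 4) = Num.sqrt 2 :> R.
Proof.
have p0 := pi_gt0 R.
have s0 : 0 < sin (pi / 4 : R) by apply: sin_gt0_pihalf; lra.
have : cos (pi / 4 *+ 2 : R) = 0.
  by rewrite -[RHS]cos_pihalf; congr cos; rewrite mulr2n; move: pi => p; field.
rewrite cos_mulr2n cos2sin2 mulr2n => e.
move: (sin _) s0 e => s s0 e; have s2 : 0 <= 2 * s by lra.
rewrite -(ger0_norm s2) -sqrtr_sqr.
by congr Num.sqrt; lra.
Qed.

End Trigonometry.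

Section DistortionBounds.
Context {R : realType} {X Y : Type}.
Variables (dX : X -> X -> R) (dY : Y -> Y -> R) (f : X -> Y).
Hypothesis dX_ge0 : forall x x', 0 <= dX x x'.
Hypothesis dY_ge0 : forall y y', 0 <= dY y y'.

(** Once the infinite cases are set aside, the extremal constants are real and themselves
    admissible, so a bound on b / a for all admissible pairs applies to them. *)
Lemma distortion_ge (L : R) :
  (exists x x', 0 < dX x x') ->
  (forall a b : R, 0 < a ->
    (forall x x', a * dX x x' <= dY (f x) (f x')) ->
    (forall x x', dY (f x) (f x') <= b * dX x x') -> L <= b / a) ->
  (L%:E <= distortion dX dY f)%E.
Proof.
move=> [x0 [x1 d01]] hL; rewrite /distortion.
set al := lower_lipschitz _ _ _; set be := upper_lipschitz _ _ _.
have al0 : (0 <= al)%E.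
  apply: ereal_sup_ubound => /=; split=> // x x'.
  by rewrite mul0e lee_fin.
have be0 : (0 <= be)%E by apply: le_ereal_inf_tmp => b [].
have [_|aln0] /= := eqVneq al 0%E; first exact: leey.
have [_|bey] := eqVneq be +oo%E; first exact: leey.
have alub x x' : 0 < dX x x' -> (al <= (dY (f x) (f x') / dX x x')%:E)%E.
  move=> d0; apply: ge_ereal_sup => a [_ /(_ x x')].
  by rewrite EFinM -lee_pdivlMr.
have belb x x' : 0 < dX x x' -> ((dY (f x) (f x') / dX x x')%:E <= be)%E.
  move=> d0; apply: le_ereal_inf_tmp => b [_ /(_ x x')].
  by rewrite EFinM -lee_pdivrMr.
(* Separating two points at distance 0 would leave only +oo as an upper constant. *)
have dY0 x x' : dX x x' = 0 -> dY (f x) (f x') <= 0.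
  move=> d0; apply: contraNT bey; rewrite -ltNge => dYp.
  rewrite -leye_eq; apply: le_ereal_inf_tmp => b [_ /(_ x x')].
  by rewrite d0 mule0 lee_fin leNgt dYp.
case: (al) al0 aln0 alub => [a||//] al0 aln0 alub; last first.
  by have := alub _ _ d01; rewrite leye_eq.
case: (be) be0 bey belb => [b||//] be0 bey belb //.
rewrite inver ifF; last by apply: contraNF aln0 => /eqP ->.
rewrite -EFinM lee_fin; apply: hL => [|x x'|x x'].
- by rewrite lt_def -!lee_fin al0 andbT; apply: contraNN aln0 => /eqP ->.
- have [d0|d0] := ltrP 0 (dX x x').
    by rewrite -ler_pdivlMr// -lee_fin alub.
  rewrite (_ : dX x x' = 0) ?mulr0 ?dY_ge0//.
  by apply/le_anti; rewrite d0 dX_ge0.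
- have [d0|d0] := ltrP 0 (dX x x').
    by rewrite -ler_pdivrMr// -lee_fin belb.
  have dX0 : dX x x' = 0 by apply/le_anti; rewrite d0 dX_ge0.
  by rewrite dX0 mulr0 dY0.
Qed.

Lemma distortion_le (a b : R) : 0 < a -> 0 <= b ->
  (forall x x', a * dX x x' <= dY (f x) (f x')) ->
  (forall x x', dY (f x) (f x') <= b * dX x x') ->
  (distortion dX dY f <= (b / a)%:E)%E.
Proof.
move=> a0 b0 ha hb; rewrite /distortion.
set al := lower_lipschitz _ _ _; set be := upper_lipschitz _ _ _.
have aal : (a%:E <= al)%E.
  apply: ereal_sup_ubound => /=; split=> [|x x']; first by rewrite lee_fin ltW.
  by rewrite -EFinM lee_fin ha.
have beb : (be <= b%:E)%E.
  apply: ereal_inf_lbound => /=; split=> [|x x']; first by rewrite lee_fin.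
  by rewrite -EFinM lee_fin hb.
have be0 : (0 <= be)%E by apply: le_ereal_inf_tmp => c [].
have al0 : (0 < al)%E by apply: lt_le_trans aal; rewrite lte_fin.
rewrite gt_eqF//= lt_eqF ?(le_lt_trans beb) ?ltry//.
rewrite EFinM -[(a^-1)%:E]/(a^-1)%:E.
have -> : (a^-1)%:E = (a%:E^-1)%E by rewrite inver gt_eqF.
apply: lee_pmul => //; first by rewrite inve_ge0 ltW.
by rewrite lee_pV2 ?inE//; [exact: ltW|rewrite lee_fin ltW].
Qed.
End DistortionBounds.

(* [z r] discretizes, in [2 ^ r.+1] steps, the circle of radius [eps] around the
   apex of a cone of total angle [2 pi / N]. *)
Lemma lipschitz_loop_bound {R : realType} {U : lmodType R}
    (ip : {dot U for @idfun R}) (X : Type) (dX : X -> X -> R) (f : X -> U)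
    (a b eps : R) (N : nat) (z : nat -> nat -> X) :
  0 < a -> 0 < eps -> (0 < N)%N ->
  (forall x x', a * dX x x' <= Num.sqrt (ip (f x - f x') (f x - f x'))) ->
  (forall x x', Num.sqrt (ip (f x - f x') (f x - f x')) <= b * dX x x') ->
  (forall r j, z r (j + 2 * 2 ^ r)%N = z r j) ->
  (forall r j, 2 * eps * sin (pi / (2 * N%:R)) <= dX (z r j) (z r (j + 2 ^ r)%N)) ->
  (forall r j, dX (z r j) (z r j.+1) <= 2 * eps * sin (pi / (2 * N%:R) / 2 ^+ r)) ->
  N%:R * sin (pi / (2 * N%:R)) <= b / a.
Proof.
move=> a0 e0 N0 fa fb zper zdiam zstep.
have p0 := pi_gt0 R; set h := pi / (2 * N%:R) : R.
have N0' : (0 : R) < N%:R by rewrite ltr0n.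
have h0 : 0 < h by rewrite divr_gt0 ?mulr_gt0.
have hpi : h <= pi / 2.
  rewrite /h ler_pM2l// lef_pV2 ?posrE ?mulr_gt0// ler_peMr// ler1n//.
have sh0 : 0 < sin h by apply: sin_gt0_pi; lra.
have b0 : 0 <= b.
  have := fb (z 0%N 0%N) (z 0%N (0 + 2 ^ 0)%N).
  move/(le_trans (sqrtr_ge0 _)); rewrite pmulr_lge0//.
  by apply: lt_le_trans (zdiam 0%N 0%N); rewrite !mulr_gt0.
(* [cycle_inequality] with antipodal points at least a * 2 eps sin h apart and neighbours at most b
   * 2 eps sin (h / 2 ^ r) apart; its constant is 2 sin(q)^2 for q = pi / 2 / 2 ^ r. *)
have key r : (0 < r)%N ->
    a * sin h * sin (pi / 2 / 2 ^+ r) <= b * sin (h / 2 ^+ r).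
  move=> r0; set k2 : R := 2 ^+ r; set q := pi / 2 / k2.
  have k20 : 2 <= k2 by rewrite /k2 -(prednK r0) exprS ler_peMr// exprn_ege1// ler1n.
  have := cycle_inequality ip (x := fun j => f (z r j)) r0 _.
  move=> /(_ _)/wrap[j|]; first by rewrite zper.
  have -> : 1 - cos (pi / k2) = 2 * sin q ^+ 2.
    have -> : pi / k2 = q *+ 2 by rewrite /q mulr2n -mulrDl -splitr.
    by rewrite cos_mulr2n cos2sin2 mulr2n; lra.
  set S1 := \sum_(j < _) _; set S2 := \sum_(j < _) _ => S12.
  have k2p : 0 < k2 by lra.
  have k21 : 1 <= k2 by lra.
  have ph : 0 < (pi : R) / 2 by lra.
  have q0 : 0 < q by rewrite divr_gt0.
  have qle : q <= pi / 2 by rewrite ler_pdivrMr// ler_peMr// ltW.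
  have sq0 : 0 <= sin q by apply: sin_ge0_pi; lra.
  have hk0 : 0 < h / k2 by rewrite divr_gt0.
  have hk : h / k2 <= h by rewrite ler_pdivrMr// ler_peMr// ltW.
  have shk : 0 < sin (h / k2) by apply: sin_gt0_pi; lra.
  set n : R := (2 * 2 ^ r)%N%:R; have n0 : 0 < n by rewrite ltr0n muln_gt0 expn_gt0.
  have nE X0 : n * X0 = \sum_(j < 2 * 2 ^ r) X0.
    by rewrite sumr_const card_ord /n mulr_natl.
  have S1ge : n * (a * (2 * eps * sin h)) ^+ 2 <= S1.
    rewrite nE.
    apply: ler_sum => j _; rewrite -[X in _ <= X]sqr_sqrtr ?ip_ge0//.
    have nn : 0 <= a * (2 * eps * sin h) by rewrite ltW ?mulr_gt0.
    rewrite ler_pXn2r ?nnegrE ?sqrtr_ge0//.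
    by apply: le_trans (fa _ _); rewrite ler_pM2l.
  have S2le : S2 <= n * (b * (2 * eps * sin (h / k2))) ^+ 2.
    rewrite nE.
    apply: ler_sum => j _; rewrite -[X in X <= _]sqr_sqrtr ?ip_ge0//.
    have nn : 0 <= b * (2 * eps * sin (h / k2)).
      by rewrite mulr_ge0// ltW ?mulr_gt0.
    rewrite ler_pXn2r ?nnegrE ?sqrtr_ge0//.
    by apply: le_trans (fb _ _) _; rewrite ler_wpM2l.
  rewrite -(ler_pM2r (_ : 0 < 2 * eps)) ?mulr_gt0//.
  have nnl : 0 <= a * sin h * sin q * (2 * eps).
    by rewrite mulr_ge0 ?mulr_ge0// ltW.
  have nnr : 0 <= b * sin (h / k2) * (2 * eps).
    by rewrite mulr_ge0 ?mulr_ge0// ltW.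
  rewrite -(@ler_pXn2r _ 2)// ?nnegrE//.
  rewrite -(ler_pM2r (_ : 0 < 2 * n)) ?mulr_gt0//.
  have : 2 * sin q ^+ 2 * (n * (a * (2 * eps * sin h)) ^+ 2) <= 2 * sin q ^+ 2 * S1.
    by rewrite ler_wpM2l// mulr_ge0// sqr_ge0.
  move=> ?; lra.
rewrite ler_pdivlMr// leNgt; apply/negP; set L := _ * sin h * a => bL.
have L0 : 0 < L by rewrite /L !mulr_gt0.
(* The limit in r is taken by contradiction. Since sin q >= q * (1 - q), [key] gives L * (1 - q) <=
   b; the first term of M makes L * q < L - b, and the summand pi makes q <= 1. *)
pose M := L * pi / (L - b) + pi; have LB : 0 < L - b by lra.
have M0 : 0 <= M by rewrite addr_ge0 ?divr_ge0 ?mulr_ge0 ?ltW.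
pose r := (Num.bound M).+1; have := key r isT.
set k2 : R := 2 ^+ r => {}key.
have k2M : M < k2.
  apply: lt_trans (archi_boundP M0) _.
  rewrite /k2 -natrX ltr_nat /r; apply: (leq_trans (ltnSn _)).
  by rewrite ltnW// ltn_expl.
have Mpi : pi <= M by rewrite lerDr divr_ge0 ?mulr_ge0 ?ltW.
have k20 : 0 < k2 by lra.
set q := pi / 2 / k2 in key.
have q01 : 0 <= q <= 1.
  by rewrite /q divr_ge0 ?ler_pdivrMr ?mul1r//=; lra.
have Lq : L * q < L - b.
  rewrite /q mulrA ltr_pdivrMr// mulrC.
  have : (L - b) * M < (L - b) * k2 by rewrite ltr_pM2l.
  rewrite /M mulrDr mulrCA divff ?gt_eqF// mulr1 => ?.
  have : 0 <= (L - b) * pi by rewrite mulr_ge0 ?ltW.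
  have : 0 <= L * pi by rewrite mulr_ge0 ?ltW.
  by move=> ? ?; rewrite mulrC; lra.
have q_pi : 0 <= q <= pi by have := pi_ge2 R; lra.
have h_k2 : sin (h / k2) <= h / k2 by apply: sin_le_id; rewrite divr_ge0 ?ltW.
have qcos : q * (1 - q) <= sin q.
  by apply: le_trans (sin_ge_cos q_pi); rewrite ler_wpM2l ?cos_ge_1B//; lra.
have : a * sin h * (q * (1 - q)) <= b * (h / k2).
  apply: le_trans (le_trans _ key) _; last by rewrite ler_wpM2l.
  by rewrite ler_wpM2l// mulr_ge0 ?ltW.
have -> : h / k2 = q / N%:R.
  by rewrite /h /q; field; rewrite !gt_eqF.
rewrite mulrCA [b * _]mulrCA => le1.
have q0 : 0 < q by rewrite /q !divr_gt0.
rewrite ler_pM2l// ler_pdivlMr// in le1.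
move: Lq le1; rewrite /L => ? ?; lra.
Qed.

(** * Euclidean space as a Hilbert space *)

Section DotNorm.
Context {R : realType} {U : lmodType R} (ip : {dot U for @idfun R}).
Implicit Types x y : U.

Definition ipnorm x : R := Num.sqrt (ip x x).

Lemma ipnorm_ge0 x : 0 <= ipnorm x.
Proof. exact: sqrtr_ge0. Qed.

Lemma sqr_ipnorm x : ipnorm x ^+ 2 = ip x x.
Proof. by rewrite sqr_sqrtr// ip_ge0. Qed.

Lemma ip_le_norm x y : ip x y <= ipnorm x * ipnorm y.
Proof.
apply: le_trans (ler_norm _) _; rewrite -sqrtr_sqr -sqrtrM ?ip_ge0//.
by rewrite ler_wsqrtr// cauchy_schwarz.
Qed.

Lemma ipnormD x y : ipnorm (x + y) <= ipnorm x + ipnorm y.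
Proof.
rewrite -(@ler_pXn2r _ 2)// ?nnegrE ?addr_ge0 ?ipnorm_ge0//.
rewrite sqrrD !sqr_ipnorm !(ipE ip) (ipC ip y x) mulr2n.
have := ip_le_norm x y => ?; lra.
Qed.

Lemma ipnormZ a x : ipnorm (a *: x) = `|a| * ipnorm x.
Proof.
by rewrite /ipnorm ipZl ipZr mulrA -expr2 sqrtrM ?sqr_ge0// sqrtr_sqr.
Qed.

Lemma ipnorm_eq0 x : (ipnorm x == 0) = (x == 0).
Proof. by rewrite -(ip_eq0 ip) -sqr_ipnorm sqrf_eq0. Qed.

Lemma ipnormB x y : ipnorm (x - y) = ipnorm (y - x).
Proof. by rewrite /ipnorm -[x - y]opprB ipNl ipNr opprK. Qed.

End DotNorm.

(** A copy of the row vectors, which already carry the sup norm; the copy receives the Euclidean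
    one. *)
Definition euc (R : realType) (n : nat) : Type := 'rV[R]_n.

Section EuclideanSpace.
Context {R : realType} {n : nat}.

HB.instance Definition _ := GRing.Lmodule.on (euc R n).

Definition eucdot (x y : euc R n) : R :=
  \sum_i (x : 'rV_n) 0 i * (y : 'rV_n) 0 i.

Lemma eucdotC x y : eucdot x y = eucdot y x.
Proof. by apply: eq_bigr => i _; rewrite mulrC. Qed.

Lemma eucdot_linear x : linear_for *%R (eucdot x).
Proof.
move=> a y z; rewrite /eucdot mulr_sumr -big_split; apply: eq_bigr => i _ /=.
by rewrite !mxE; ring.
Qed.

Lemma eucdot_bilinear : bilinear_for *%R *%R eucdot.
Proof.
split=> x; last exact: eucdot_linear.
by move=> a y z; rewrite !(eucdotC _ x) eucdot_linear.
Qed.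

HB.instance Definition _ := bilinear_isBilinear.Build R (euc R n) (euc R n) R
  *%R *%R eucdot eucdot_bilinear.

Lemma eucdot_hermitian x y : eucdot x y = (-1) ^+ false * idfun (eucdot y x).
Proof. by rewrite expr0 mul1r eucdotC. Qed.

HB.instance Definition _ := isHermitianSesquilinear.Build R (euc R n)
  false (@idfun R) eucdot eucdot_hermitian.

Lemma eucdot_gt0 x : x != 0 -> 0 < eucdot x x.
Proof.
move=> x0; rewrite lt_def sumr_ge0 ?andbT => [|i _]; last first.
  by rewrite -expr2 sqr_ge0.
apply: contraNneq x0 => x0; apply/eqP/rowP => i; rewrite mxE.
have := @psumr_eq0P R _ xpredT (fun i => x 0 i * x 0 i).
move=> /(_ _ x0 i isT)/wrap[j _|/eqP]; first by rewrite -expr2 sqr_ge0.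
by rewrite mulf_eq0 orbb => /eqP.
Qed.

HB.instance Definition _ := isDotProduct.Build R (euc R n) eucdot eucdot_gt0.

Definition eucdot_dot : {dot euc R n for @idfun R} := eucdot.

HB.instance Definition _ := Lmodule_isNormed.Build R (euc R n)
  (ipnormD eucdot_dot) (ipnormZ eucdot_dot)
  (fun x h => eqP (etrans (esym (ipnorm_eq0 eucdot_dot x)) (introT eqP h))).

Lemma euc_normE (x : euc R n) : `|x| = ipnorm eucdot_dot x.
Proof. by []. Qed.

Lemma euc_complete (F : set_system (euc R n)) :
  ProperFilter F -> cauchy F -> cvg F.
Proof.
move=> FF /cauchy_ballP Fc.
have coord_le (x : euc R n) i : `|(x : 'rV_n) 0 i| <= `|x|.
  rewrite euc_normE -(@ler_pXn2r _ 2)// ?nnegrE ?ipnorm_ge0// sqr_ipnorm.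
  rewrite real_normK ?num_real// /= /eucdot (bigD1 i)//= -expr2 lerDl.
  by rewrite sumr_ge0// => j _; rewrite -expr2 sqr_ge0.
have cvg_coord i : cvg ((fun x : euc R n => (x : 'rV_n) 0 i) @ F).
  apply: cauchy_cvg; apply/cauchy_ballP => e e0 /=.
  rewrite near_simpl; apply: filterS (Fc e e0).
  move=> [x y] /=; rewrite -!ball_normE /= => xy.
  apply: le_lt_trans xy; rewrite (_ : _ - _ = ((x - y : euc R n) : 'rV_n) 0 i) //.
  by rewrite !mxE.
pose l : euc R n := \row_i lim ((fun x : euc R n => (x : 'rV_n) 0 i) @ F).
apply/cvg_ex; exists l; apply/fcvgrPdist_lt => e e0.
(* Coordinates within d give a squared norm at most n * d ^ 2 < e ^ 2; the successor also covers n =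
   0. *)
pose d := e / n.+1%:R; have d0 : 0 < d by rewrite divr_gt0.
have : \forall x \near F, forall i, `|l 0 i - (x : 'rV_n) 0 i| < d.
  apply: filter_forall => i; rewrite mxE.
  by have /cvgrPdist_lt/(_ d d0) := cvg_coord i.
apply: filterS => x lx; rewrite euc_normE.
rewrite -(@ltr_pXn2r _ 2)// ?nnegrE ?ipnorm_ge0 ?ltW// sqr_ipnorm.
apply: (@le_lt_trans _ _ (\sum_(i < n) d ^+ 2)).
  apply: ler_sum => i _; rewrite !mxE -expr2 -real_normK ?num_real//.
  by rewrite ler_pXn2r// ?nnegrE ?ltW//; have := lx i; rewrite mxE.
rewrite sumr_const card_ord -mulr_natl /d expr_div_n mulrCA.
rewrite gtr_pMr ?exprn_gt0// ltr_pdivrMr ?exprn_gt0// mul1r -natrX ltr_nat.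
by rewrite expnS expn1 mulSn; lia.
Qed.

HB.instance Definition _ := Uniform_isComplete.Build (euc R n) euc_complete.

End EuclideanSpace.

(** * Frames, generic vectors and reflections *)

(** The block matrix with rows (1, c) and (r, 1) is factored through each of its two Schur
    complements. *)
Lemma det_sub_rank1 (R : comUnitRingType) (m : nat) (c : 'cV[R]_m) (r : 'rV[R]_m) :
  \det (1%:M - c *m r) = 1 - (r *m c) 0 0.
Proof.
have e : block_mx (1%:M - c *m r) c 0 1%:M *m block_mx 1%:M 0 r 1%:M =
    block_mx 1%:M 0 r 1%:M *m block_mx 1%:M c 0 (1%:M - r *m c).
  by rewrite !mulmx_block !mulmx1 !mul1mx !mulmx0 !mul0mx !addr0 !add0r
    subrK addrC subrK.
have := congr1 determinant e.
rewrite !det_mulmx !det_ublock !det_lblock !det1 !mulr1 !mul1r => ->.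
by rewrite det_mx11 !mxE eqxx.
Qed.

Section LinearMapDeterminant.
Context {R : realType} {V : vectType R}.

Definition lfun_det (g : 'End(V)) : R :=
  \det (passmx.mxof (vbasis {:V}) (vbasis {:V}) g).

Lemma lfun_det_comp g h : lfun_det (g \o h)%VF = lfun_det g * lfun_det h.
Proof.
by rewrite /lfun_det (passmx.mxof_comp _ _ (vbasisP {:V})) det_mulmx mulrC.
Qed.

Lemma lfun_det1 : lfun_det \1%VF = 1.
Proof. by rewrite /lfun_det passmx.mxof1 ?det1// (basis_free (vbasisP _)). Qed.

End LinearMapDeterminant.

Section Eventually.

(** Genericity is obtained along lines v + t u with t a natural number: finitely many conditions,
    each eventually true, are met together. *)
Lemma eventually_all (T : eqType) (s : seq T) (P : T -> nat -> Prop) :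
  (forall x, x \in s -> exists N, forall t, (N <= t)%N -> P x t) ->
  exists N, forall t, (N <= t)%N -> forall x, x \in s -> P x t.
Proof.
elim: s => [|x s IH] h; first by exists 0%N.
have [N1 hN1] := h x (mem_head _ _).
have [y ys|N2 hN2] := IH; first by apply: h; rewrite inE ys orbT.
exists (maxn N1 N2) => t; rewrite geq_max => /andP[t1 t2] y.
by rewrite inE => /predU1P[->|]; [exact: hN1|exact: hN2].
Qed.

Lemma eventually_once (P : nat -> Prop) :
  (forall t u, P t -> P u -> t = u) -> exists N, forall t, (N <= t)%N -> ~ P t.
Proof.
move=> Pone; have [[t0 Pt0]|nP] := pselect (exists t, P t); last first.
  by exists 0%N => t _ Pt; apply: nP; exists t.
by exists t0.+1 => t lt /(Pone _ _ Pt0) e; move: lt; rewrite e ltnn.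
Qed.

End Eventually.

Section Frames.
Context {R : realType} {V : vectType R} (ip : {dot V for @idfun R}).
Implicit Types (x y : V) (o s : seq V).

Definition frame o x := x = \sum_(y <- o) ip x y *: y.

Lemma frame_span o s : {in s, forall x, frame o x} ->
  {in span s, forall x, frame o x}.
Proof.
move=> so x /(coord_span (X := in_tuple s)) ->.
rewrite /frame; under [RHS]eq_bigr => y _ do rewrite ipC linear_sum scaler_suml.
rewrite exchange_big; apply: eq_bigr => i _ /=.
under eq_bigr => y _ do rewrite linearZ /= -scalerA ipC.
by rewrite -scaler_sumr -so// mem_nth.
Qed.

(* A Parseval frame: the Gram-Schmidt process, keeping only the expansion
   formula, which already gives [ip x x = \sum_(y <- o) ip x y ^+ 2]. *)
Lemma exists_frame : exists o, forall x, frame o x.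
Proof.
suff h s : exists o, {in o, forall x, frame o x} /\ {in s, forall x, frame o x}.
  have [fr [_ vfr]] := h (vbasis {:V}); exists fr => x; apply: (frame_span vfr).
  by rewrite (span_basis (vbasisP _)) memvf.
elim: s => [|v s IH]; first by exists [::]; split=> x; rewrite in_nil.
case: IH => o [oo so].
set p := \sum_(y <- o) ip v y *: y; pose w := v - p.
have ow x : frame o x -> ip x w = 0.
  move=> xo; rewrite ipDr ipNr /p ip_sumr {1}xo ipC ip_sumr -sumrB big1// => y _.
  by rewrite !ipZr mulrC subrr.
have [w0|wn0] := eqVneq w 0.
  exists o; split=> // x; rewrite inE => /predU1P[->|/so//].
  by apply/eqP; rewrite -subr_eq0 -/p -/w w0.
have ww := ip_gt0 ip wn0; pose e := (Num.sqrt (ip w w))^-1 *: w.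
have ee : ip e e = 1.
  rewrite ipZl ipZr mulrA -invfM -expr2 sqr_sqrtr ?ltW// mulVf// gt_eqF//.
have oe x : frame o x -> frame (e :: o) x.
  by move=> xo; rewrite /frame big_cons ipZr (ow _ xo) mulr0 scale0r add0r.
have oE y : y \in o -> ip e y = 0.
  by move=> /oo/ow yw; rewrite ipZl ipC yw mulr0.
have fe : frame (e :: o) e.
  rewrite /frame big_cons ee scale1r big_seq big1 ?addr0// => y /oE ->.
  by rewrite scale0r.
exists (e :: o); split=> x; rewrite inE => /predU1P[->//|]; first by move=> /oo/oe.
- rewrite /frame big_cons -/p.
  have -> : ip v e = Num.sqrt (ip w w).
    have pw : ip p w = 0.
      rewrite ipC /p ip_sumr big_seq big1// => y /oo/ow yw.
      by rewrite ipZr (ipC ip w y) yw mulr0.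
    have : ip (w + p) w = ip w w by rewrite ipDl pw addr0.
    rewrite subrK ipZr => ->.
    by rewrite -{2}(sqr_sqrtr (ltW ww)) expr2 mulKf// gt_eqF// sqrtr_gt0.
  by rewrite scalerA divff ?gt_eqF ?sqrtr_gt0// scale1r subrK.
- by move=> /so/oe.
Qed.

Lemma frame_norm o x : frame o x -> ip x x = \sum_(y <- o) ip x y ^+ 2.
Proof.
by move=> xo; rewrite {2}xo ip_sumr; apply: eq_bigr => y _; rewrite ipZr expr2.
Qed.

End Frames.

Section GenericVectors.
Context {R : realType} {V : vectType R} (ip : {dot V for @idfun R}).

(** Two values of t with v + t u in A would put a nonzero multiple of u in A. *)
Lemma vspace_line_avoid (A : {vspace V}) (u v : V) : u \notin A ->
  exists N, forall t, (N <= t)%N -> v + t%:R *: u \notin A.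
Proof.
move=> uA; have [t s|N h] :=
    @eventually_once (fun t => v + t%:R *: u \in A); last first.
  by exists N => t /h /negP.
move=> tA sA; apply/eqP; rewrite -(eqr_nat R) -subr_eq0.
apply: contraNT uA => ts.
have := rpredB tA sA; rewrite opprD addrACA subrr add0r -scalerBl => h.
by move: h; rewrite rpredZeq (negPf ts).
Qed.

(** If the vector u found for the tail falls into A, start from a vector of U outside A and move far
    along u: this stays outside A and leaves the other subspaces. *)
Lemma vspace_avoid (U : {vspace V}) (s : seq {vspace V}) :
  (forall A, A \in s -> ~~ (U <= A)%VS) ->
  exists2 x, x \in U & forall A, A \in s -> x \notin A.
Proof.
elim: s => [|A s IH] h; first by exists 0; rewrite ?mem0v.
have [B Bs|u uU us] := IH; first by apply: h; rewrite inE Bs orbT.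
have [uA|uA] := boolP (u \in A); last first.
  by exists u => // B; rewrite inE => /predU1P[->//|/us].
have /subvPn[v vU vA] := h A (mem_head _ _).
have [N hN] := eventually_all (fun B Bs => vspace_line_avoid v (us B Bs)).
exists (v + N%:R *: u); first by rewrite rpredD ?rpredZ.
move=> B; rewrite inE => /predU1P[->|Bs]; last exact: hN.
by rewrite rpredDr ?rpredZ.
Qed.

Lemma dot_avoid (s : seq V) : 0 \notin s ->
  exists u, forall v, v \in s -> ip u v != 0.
Proof.
move=> s0; have [_ /mapP[v vs ->]|u _ us] :=
    @vspace_avoid fullv [seq orthov ip <[v]>%VS | v <- s].
  apply: contraNN s0 => /subvP/(_ v (memvf _)).
  by rewrite mem_orthov1 ip_eq0 => /eqP <-.
exists u => v vs; rewrite -mem_orthov1; apply: us.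
by apply/mapP; exists v.
Qed.

(** Both conditions on y are invariant under positive scaling, so x plus a small multiple of a
    generic u becomes u plus a large natural multiple of x. *)
Lemma generic_perturbation (x : V) (P Z : seq V) :
  (forall b, b \in P -> 0 < ip x b) -> 0 \notin Z ->
  exists2 y, (forall b, b \in P -> 0 < ip y b) &
    forall z, z \in Z -> ip y z != 0.
Proof.
move=> xP /dot_avoid[u uZ].
have [N1 h1] : exists N, forall t, (N <= t)%N -> forall b, b \in P ->
    0 < ip (u + t%:R *: x) b.
  apply: eventually_all => b bP; exists (Num.bound (`|ip u b| / ip x b)) => t lt.
  have xb := xP b bP; rewrite ipDl ipZl.
  have : `|ip u b| / ip x b < t%:R.
    apply: (lt_le_trans (archi_boundP _)); last by rewrite ler_nat.
    by rewrite divr_ge0// ltW.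
  rewrite ltr_pdivrMr// => h; have := ler_norm (- ip u b); rewrite normrN => ?.
  by lra.
have [N2 h2] : exists N, forall t, (N <= t)%N -> forall z, z \in Z ->
    ip (u + t%:R *: x) z != 0.
  apply: eventually_all => z /uZ uz; have [xz|xz] := eqVneq (ip x z) 0.
    by exists 0%N => t _; rewrite ipDl ipZl xz mulr0 addr0.
  have [|N h] := @vspace_line_avoid (orthov ip <[z]>%VS) x u.
    by rewrite mem_orthov1.
  by exists N => t /h; rewrite mem_orthov1.
exists (u + (maxn N1 N2)%:R *: x) => b; first exact/h1/leq_maxl.
exact/h2/leq_maxr.
Qed.

End GenericVectors.

Section Reflections.
Context {R : realType} {V : vectType R} (ip : {dot V for @idfun R}).
Implicit Types (a x y : V) (g : 'End(V)).

(** The reflection in the hyperplane normal to a, when a is a unit vector. *)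
Definition refl_fun a x := x - (2 * ip x a) *: a.

Lemma refl_fun_linear a : linear (refl_fun a).
Proof.
move=> k x y; rewrite /refl_fun ipDl ipZl scalerBr scalerA addrACA -opprD.
by rewrite -scalerDl mulrDr mulrCA.
Qed.

HB.instance Definition _ a := GRing.isLinear.Build R V V *:%R (refl_fun a)
  (refl_fun_linear a).

Definition refl a : 'End(V) := linfun (refl_fun a).

Lemma reflE a x : refl a x = x - (2 * ip x a) *: a.
Proof. by rewrite lfunE. Qed.

Lemma refl_fixed a x : ip x a = 0 -> refl a x = x.
Proof. by rewrite reflE => ->; rewrite mulr0 scale0r subr0. Qed.

Lemma reflN a : refl (- a) = refl a.
Proof. by apply/lfunP => x; rewrite !reflE ipNr mulrN scalerN scaleNr opprK. Qed.

Section UnitNormal.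
Variable a : V.
Hypothesis a1 : ip a a = 1.

Lemma refl_normal : refl a a = - a.
Proof. by rewrite reflE a1 mulr1 scaler_nat mulr2n opprD addNKr. Qed.

Lemma ip_refl x y : ip (refl a x) y = ip x (refl a y).
Proof. by rewrite !reflE !(ipE ip) (ipC ip a y); ring. Qed.

Lemma refl_invol x : refl a (refl a x) = x.
Proof.
have e : ip (refl a x) a = - ip x a by rewrite reflE !(ipE ip) a1; ring.
by rewrite [LHS]reflE e reflE mulrN scaleNr opprK subrK.
Qed.

Lemma refl_comp : (refl a \o refl a)%VF = \1%VF.
Proof. by apply/lfunP => x; rewrite lfunE /= refl_invol lfunE. Qed.

Lemma refl_orthogonal : orthogonal_maps ip (refl a).
Proof. by move=> x y; rewrite ip_refl refl_invol. Qed.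

Lemma refl_fixedP x : (x \in fixedSpace (refl a)) = (ip x a == 0).
Proof.
apply/fixedSpaceP/eqP => [|/refl_fixed//].
move=> /(congr1 (fun y => ip y a)); rewrite reflE !(ipE ip) a1 => h; lra.
Qed.

Lemma refl_is_reflection : reflection ip (refl a).
Proof.
split; first exact: refl_orthogonal.
have an0 : a != 0 by rewrite -(ip_eq0 ip) a1 oner_eq0.
exists (orthov ip <[a]>%VS); split => [|x|y yH].
- have := @eq_dim_orthov1 _ _ _ _ ip a fullv.
  rewrite capfv => <-; last first.
    have := oner_neq0 R; rewrite -a1 => aa.
    by apply/mem_orthovPn; exists a; rewrite ?memvf.
  by rewrite prednK// lt0n dimv_eq0 -subv0; apply: contraNN an0 => /subvP/(_ a (memvf _)); rewrite memv0.
- by rewrite mem_orthov1 => /eqP/refl_fixed.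
- have yE : y = ip y a *: a.
    apply/eqP; rewrite -subr_eq0 -(ip_eq0 ip); apply/eqP.
    pose z := y - ip y a *: a; rewrite -/z.
    have za : ip z a = 0 by rewrite ipDl ipNl ipZl a1 mulr1 subrr.
    have zy : ip z y = 0 by apply: yH; rewrite mem_orthov1; apply/eqP.
    by rewrite {2}/z ipDr ipNr ipZr za zy mulr0 subr0.
  by rewrite reflE {1}yE -scalerBl mulr2n mulrDl mul1r opprD addNKr scaleNr -yE.
Qed.

(** In coordinates the reflection is the identity minus c *m r, and r *m c is 2 * ip a a = 2. *)
Lemma det_refl : lfun_det (refl a) = -1.
Proof.
rewrite /lfun_det; set e := vbasis _.
have eb : basis_of {:V} e := vbasisP _.
pose r := passmx.rVof e a; pose c : 'cV_(\dim {:V}) := \col_i (2 * ip e`_i a).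
have lin k x : passmx.rVof e (x - k *: a) = passmx.rVof e x - k *: r.
  by rewrite -scaleNr addrC passmx.rVof_linear scaleNr addrC.
rewrite (_ : passmx.mxof _ _ _ = 1%:M - c *m r); last first.
  apply/row_matrixP => i; rewrite rowE passmx.mul_mxof passmx.vecof_delta reflE.
  rewrite lin (passmx.rVofE eb); apply/rowP => j.
  by rewrite !mxE big_ord1 !mxE eqxx /= eq_sym.
rewrite det_sub_rank1 mxE.
rewrite (eq_bigr (fun i => 2 * ip (coord e i a *: e`_i) a)); last first.
  by move=> i _; rewrite !mxE ipZl mulrCA.
rewrite -mulr_sumr; under eq_bigr => i _ do rewrite (ipC ip _ a).
rewrite -ip_sumr -(coord_basis eb (memvf a)) a1; lra.
Qed.

End UnitNormal.

End Reflections.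

Section OrthogonalGroups.
Context {R : realType} {V : vectType R} (ip : {dot V for @idfun R}).
Implicit Types (x y a : V) (g h : 'End(V)) (S T : set 'End(V)).

Lemma orthogonal_lker0 g : orthogonal_maps ip g -> lker g == 0%VS.
Proof.
move=> og; apply/lker0P => x y gxy; apply/eqP; rewrite -subr_eq0 -(ip_eq0 ip).
by rewrite -og linearB /= gxy subrr ip0l.
Qed.

Lemma orthogonalK g : orthogonal_maps ip g -> cancel g (g^-1)%VF.
Proof. by move=> /orthogonal_lker0/lker0_lfunK. Qed.

Lemma orthogonalVK g : orthogonal_maps ip g -> cancel (g^-1)%VF g.
Proof. by move=> /orthogonal_lker0/lker0_lfunVK. Qed.

Lemma orthogonalV g : orthogonal_maps ip g -> orthogonal_maps ip (g^-1)%VF.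
Proof. by move=> og x y; rewrite -og !orthogonalVK. Qed.

Lemma ip_orthogonalV g x y : orthogonal_maps ip g -> ip (g x) y = ip x ((g^-1)%VF y).
Proof. by move=> og; rewrite -[in LHS](orthogonalVK og y) og. Qed.

Lemma orthogonal_subgroup_full : orthogonal_subgroup ip (orthogonal_maps ip).
Proof.
split=> // [x y|g h og oh x y|g og]; first by rewrite !lfunE.
  by rewrite !lfunE /= og oh.
exact: orthogonalV.
Qed.

Lemma orthogonal_subgroup_smallest S : S `<=` orthogonal_maps ip ->
  orthogonal_subgroup ip (smallest (orthogonal_subgroup ip) S).
Proof.
move=> So; split=> [||g h Gg Gh|g Gg].
- exact: smallest_sub orthogonal_subgroup_full So.
- by move=> T [[]].
- by move=> T TS; have [[_ _ Tc _] _] := TS; apply: Tc; [exact: Gg|exact: Gh].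
- by move=> T TS; have [[_ _ _ Tv] _] := TS; apply: Tv; exact: Gg.
Qed.

(** Each orthogonality condition costs at most one dimension; for a basis of a hyperplane this
    leaves a normal vector. *)
Lemma orthogonal_complement_dim (s : seq V) :
  exists2 U : {vspace V}, (\dim {:V} <= \dim U + size s)%N &
    forall x y, x \in U -> y \in s -> ip x y = 0.
Proof.
elim: s => [|y s [U dU oU]]; first by exists fullv => [|x y _]; rewrite ?addn0 ?in_nil.
exists (U :&: orthov ip <[y]>)%VS => [|x z].
  have := leq_dim_orthov1 ip y U; rewrite /=; lia.
rewrite memv_cap mem_orthov1 => /andP[xU /eqP xy].
by rewrite inE => /predU1P[->//|]; exact: oU.
Qed.

Lemma normalize_vector y : y != 0 ->
  exists2 c, 0 < c & ip (c *: y) (c *: y) = 1.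
Proof.
move=> /(ip_gt0 ip) yy; exists (Num.sqrt (ip y y))^-1.
  by rewrite invr_gt0 sqrtr_gt0.
rewrite ipZl ipZr mulrA -expr2 exprVn sqr_sqrtr ?ltW// mulVf// gt_eqF//.
Qed.

(** A dimension count gives H a unit normal a and shows that H is its whole orthogonal space; s and
    [refl ip a] then agree on H and on a. *)
Lemma reflection_refl (s : 'End(V)) : reflection ip s ->
  exists2 a, ip a a = 1 & s = refl ip a.
Proof.
move=> [os [H [dH sH sHo]]].
have [U dU oU] := orthogonal_complement_dim (vbasis H).
have : vpick U != 0.
  rewrite vpick0 -dimv_eq0; move: dU dH; rewrite size_tuple; lia.
move: (vpick U) (memv_pick U) => y yU yn0.
have [c c0 cy1] := normalize_vector yn0; exists (c *: y) => //.
set a := c *: y in cy1 *; have aU : a \in U by rewrite rpredZ.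
have Ha x : x \in H -> ip x a = 0.
  move=> xH; rewrite (coord_vbasis xH) ipC ip_sumr big1// => i _.
  by rewrite ipZr oU ?mulr0// mem_nth// size_tuple.
have HE : H = orthov ip <[a]>%VS.
  apply/eqP; rewrite eqEdim; apply/andP; split.
    by apply/subvP => x /Ha xa; rewrite mem_orthov1; apply/eqP.
  have aa := oner_neq0 R; rewrite -cy1 in aa.
  have := @eq_dim_orthov1 _ _ _ _ ip a fullv; rewrite capfv => <-.
    by rewrite -dH.
  by apply/mem_orthovPn; exists a; rewrite ?memvf.
apply/lfunP => x; rewrite reflE.
have xa : x - ip x a *: a \in H.
  have xa0 : ip (x - ip x a *: a) a = 0 by rewrite ipDl ipNl ipZl cy1 mulr1 subrr.
  by rewrite HE mem_orthov1; apply/eqP.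
rewrite -{1}(subrK (ip x a *: a) x) linearD /= (sH _ xa).
rewrite [s (_ *: _)]linearZ /= (sHo _ Ha).
by rewrite scalerN -addrA -opprD -scalerDl mulr2n mulrDl mul1r.
Qed.

Lemma refl_conj g a : orthogonal_maps ip g ->
  (refl ip (g a) \o g)%VF = (g \o refl ip a)%VF.
Proof.
move=> og; apply/lfunP => x; rewrite !lfunE /= !reflE og linearB /=.
by rewrite [g (_ *: _)]linearZ.
Qed.

Lemma refl_inj a b : ip a a = 1 -> ip b b = 1 -> refl ip a = refl ip b ->
  b = a \/ b = - a.
Proof.
move=> a1 b1 ab; have : refl ip a b = - b by rewrite ab refl_normal.
rewrite reflE => e; have {}e : b = ip b a *: a.
  apply: (@scalerI _ _ 2); rewrite ?pnatr_eq0// scalerA -[in LHS](subrK b (2 *: b)).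
  have -> : 2 *: b - b = b by rewrite scaler_nat mulr2n addrK.
  by apply/eqP; rewrite -subr_eq0 -addrA e subrr.
have : ip b b = ip b a ^+ 2 by rewrite {1 2}e ipZl ipZr a1; ring.
rewrite b1 => /esym/eqP; rewrite sqrf_eq1 => /orP[]/eqP c; rewrite e c ?scale1r ?scaleN1r; by [left|right].
Qed.

End OrthogonalGroups.

(** * Roots, walls and the Weyl chamber *)

Lemma pos_lower_bound (R : realFieldType) (T : eqType) (s : seq T) (f : T -> R) :
  (forall x, x \in s -> 0 < f x) ->
  exists2 e, 0 < e & forall x, x \in s -> e <= f x.
Proof.
elim: s => [|x s IH] fs; first by exists 1.
have [y ys|e e0 es] := IH; first by apply: fs; rewrite inE ys orbT.
exists (Num.min (f x) e) => [|y].
  by rewrite lt_min e0 fs ?mem_head.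
by rewrite inE ge_min => /predU1P[->|/es ->]; rewrite ?lexx ?orbT.
Qed.

Lemma seq_argmin (R : realDomainType) (T : eqType) (s : seq T) (f : T -> R) :
  s != [::] -> exists2 x, x \in s & forall y, y \in s -> f x <= f y.
Proof.
elim: s => [//|x [|z s] IH] _.
  by exists x; [exact: mem_head|move=> y; rewrite inE => /eqP ->].
have [//|m ms fm] := IH; have [le|lt] := leP (f x) (f m).
  exists x => [|y]; first exact: mem_head.
  by rewrite inE => /predU1P[->//|/fm]; exact: le_trans.
exists m => [|y]; first by rewrite inE ms orbT.
by rewrite inE => /predU1P[->|/fm//]; exact: ltW.
Qed.

Section RootSystem.
Context {R : realType} {V : vectType R} (ip : {dot V for @idfun R}).
Variable W : set 'End(V).
Implicit Types (a b x y z p : V) (g h : 'End(V)) (l : seq V).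

Hypothesis W_group : orthogonal_subgroup ip W.
Hypothesis W_finite : finite_set W.

Let W_orth g : W g -> orthogonal_maps ip g.
Proof. by case: W_group => + _ _ _; exact. Qed.

Let W_comp g h : W g -> W h -> W (g \o h)%VF.
Proof. by case: W_group => _ _ + _; exact. Qed.

Let W_inv g : W g -> W (g^-1)%VF.
Proof. by case: W_group => _ _ _; exact. Qed.

(** Roots have length one, so each reflection of W has exactly two, opposite to each other. *)
Definition unit_root a := ip a a = 1 /\ W (refl ip a).

Lemma rootN a : unit_root a -> unit_root (- a).
Proof. by move=> [a1 Wa]; split; rewrite ?reflN// ipNl ipNr opprK. Qed.

Lemma root_act g a : W g -> unit_root a -> unit_root (g a).
Proof.
move=> Wg [a1 Wa]; have og := W_orth Wg; split; first by rewrite og.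
have -> : refl ip (g a) = ((g \o refl ip a) \o g^-1)%VF.
  by rewrite -refl_conj// lker0_compfK// (orthogonal_lker0 og).
by apply: W_comp; [exact: W_comp|exact: W_inv].
Qed.

Variable x0 : V.
Hypothesis x0_regular : forall a, unit_root a -> ip x0 a != 0.

(* Positivity is relative to the fixed regular vector [x0]. *)
Definition posroot a := unit_root a /\ 0 < ip x0 a.

Lemma posrootVN a : unit_root a -> posroot a \/ posroot (- a).
Proof.
move=> ra; have := x0_regular ra; rewrite neq_lt => /orP[lt|gt].
  by right; split; [exact: rootN|rewrite ipNr oppr_gt0].
by left.
Qed.

Lemma posroot_notN a : posroot a -> ~ posroot (- a).
Proof. by move=> [_ a0] [_]; rewrite ipNr oppr_gt0 => /(lt_trans a0); rewrite ltxx. Qed.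

Lemma posroot_refl_inj a b : posroot a -> posroot b -> refl ip a = refl ip b -> a = b.
Proof.
move=> pa pb ab; have [[a1 _] _] := pa; have [[b1 _] _] := pb.
have [//|ba] := refl_inj a1 b1 ab.
by have := posroot_notN pa; rewrite -ba.
Qed.

Lemma posroots_seq : exists P : seq V, forall a, (a \in P) <-> posroot a.
Proof.
have [sW sWE] := (finite_seqP W).1 W_finite.
(* Positive roots are recovered from their reflections in the finite W; the default 0 is not a root
   and is filtered out. *)
pose nrm g := xget 0 [set a | posroot a /\ refl ip a = g].
exists [seq a <- [seq nrm g | g <- sW] | `[< posroot a >]] => a.
rewrite mem_filter; split=> [/andP[/asboolP]//|pa].
apply/andP; split; first exact/asboolP.
have [[_ Wa] _] := pa; apply/mapP; exists (refl ip a).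
  by move: Wa; rewrite sWE.
rewrite /nrm; case: xgetP => [b _ [pb /esym]|/(_ a)]; first exact: posroot_refl_inj.
by case.
Qed.

Lemma argmax_group (G : set 'End(V)) (f : 'End(V) -> R) : finite_set G -> G !=set0 ->
  exists2 g, G g & forall h, G h -> f h <= f g.
Proof.
move=> /finite_seqP[s ->] [g0 gs]; have [|g gin gmin] := @seq_argmin _ _ s (fun g => - f g).
  by apply: contraPneq gs => ->.
by exists g => // h /gmin; rewrite lerN2.
Qed.

Definition dominant x := forall a, posroot a -> 0 <= ip x a.

(** The simple roots, described geometrically: p is a relative interior point of the face that the
    chamber has on the mirror of a. *)
Definition wallroot a :=
  posroot a /\ exists2 p, ip p a = 0 & forall b, posroot b -> b <> a -> 0 < ip p b.

(** The reflection fixes the wall point p, so ip p (refl ip a b) = ip p b > 0, which excludes every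
    negative root. *)
Lemma wallroot_permutes a b : wallroot a -> posroot b -> b <> a ->
  posroot (refl ip a b).
Proof.
move=> [[[a1 Wa] a0] [p pa pb]] rb ba; have [rrb _] := rb.
have [//|rN] := posrootVN (root_act Wa rrb).
have pp : 0 < ip p (refl ip a b) by rewrite -ip_refl// refl_fixed// pb.
have : 0 < ip p (- refl ip a b).
  apply: pb => // e; apply: ba.
  rewrite -(refl_invol a1 b) -[refl ip a b]opprK e linearN /= refl_normal//.
  by rewrite opprK.
by rewrite ipNr oppr_gt0 => /(lt_trans pp); rewrite ltxx.
Qed.

(* If [z] has a negative root, the segment from a generic point of the chamber
   to [z] leaves the chamber through a wall. *)
Lemma walls_suffice z : (forall a, wallroot a -> 0 <= ip z a) -> dominant z.
Proof.
move=> zw b0 pb0; rewrite leNgt; apply/negP => zb0.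
have [P PE] := posroots_seq.
pose N := [seq b <- P | ip z b < 0].
have NE b : (b \in N) <-> (posroot b /\ ip z b < 0).
  by rewrite mem_filter; split=> [/andP[-> /PE]|[/PE -> ->]].
(* The root b vanishes on x1 + t z at the time t b below. Two roots vanish together when x1 is
   orthogonal to such a vector, so a generic x1 crosses one mirror at a time. *)
pose Z := [seq u <- [seq ip z b' *: b - ip z b *: b' | b <- N, b' <- N] | u != 0].
have [b /PE[_]//||x1 x1P x1Z] := @generic_perturbation R V ip x0 P Z.
  by rewrite mem_filter eqxx.
pose t b := ip x1 b / - ip z b.
have [|a /NE[pa za] tmin] := @seq_argmin _ _ N t.
  by apply/eqP => N0; have := (NE b0).2 (conj pb0 zb0); rewrite N0 in_nil.
have tne b : b \in N -> b <> a -> t a < t b.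
  move=> bN ba; rewrite lt_neqAle tmin// andbT; apply/eqP => tab.
  have /NE[pb zb] := bN; have /NE aN : posroot a /\ ip z a < 0 by [].
  have un0 : ip z a *: b - ip z b *: a != 0.
    apply/eqP => /eqP; rewrite subr_eq0 => /eqP e.
    have : ip z a ^+ 2 = ip z b ^+ 2.
      have [[a1 _] _] := pa; have [[b1 _] _] := pb.
      have := congr1 (fun u => ip u u) e; rewrite !ipZl !ipZr a1 b1 !mulr1.
      by rewrite -!expr2.
    move/eqP; rewrite eqf_sqr => /orP[/eqP zab|/eqP zab]; last lra.
    apply: ba; move: e; rewrite zab => /scalerI -> //; exact: ltr0_neq0.
  have : ip x1 (ip z a *: b - ip z b *: a) != 0.
    apply: x1Z; rewrite mem_filter un0 /=.
    by apply/allpairsP; exists (b, a).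
  apply/negP; rewrite negbK ipDr ipNr !ipZr subr_eq0; apply/eqP.
  move: tab; rewrite /t; have zan := ltr0_neq0 za; have zbn := ltr0_neq0 zb.
  move/eqP; rewrite eqr_div ?oppr_eq0// !mulrN eqr_opp => /eqP e.
  by rewrite mulrC -e mulrC.
have ta0 : 0 < t a by rewrite divr_gt0 ?oppr_gt0//; apply: x1P; exact/PE.
suff /zw : wallroot a by rewrite leNgt za.
split=> //; exists (x1 + t a *: z) => [|b pb ba].
  by rewrite ipDl ipZl /t invrN mulrN mulNr divfK ?subrr// ltr0_neq0.
rewrite ipDl ipZl; have x1b : 0 < ip x1 b by apply: x1P; exact/PE.
have [zb|zb] := ltrP (ip z b) 0; last by rewrite ltr_wpDr// mulr_ge0// ltW.
have := tne b ((NE b).2 (conj pb zb)) ba.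
rewrite {2}/t ltr_pdivlMr ?oppr_gt0// => h; lra.
Qed.

Definition wall_group : set 'End(V) :=
  smallest (orthogonal_subgroup ip) [set refl ip a | a in wallroot].

Let wall_refl_orth : [set refl ip a | a in wallroot] `<=` orthogonal_maps ip.
Proof. by move=> _ [a [[[a1 _] _] _] <-]; exact: refl_orthogonal. Qed.

Lemma wall_group_subgroup : orthogonal_subgroup ip wall_group.
Proof. exact: orthogonal_subgroup_smallest wall_refl_orth. Qed.

Lemma wall_group_refl a : wallroot a -> wall_group (refl ip a).
Proof. by move=> wa T [_]; apply; exists a. Qed.

Lemma wall_group_sub : wall_group `<=` W.
Proof. by apply: smallest_sub W_group _ => _ [a [[[_ Wa] _] _] <-]. Qed.

(** Maximize ip x0 (w z) over the wall group: reflecting in a wall root negative on w z would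
    increase it. *)
Lemma dominant_wall_group z : exists2 w, wall_group w & dominant (w z).
Proof.
have [_ T1 Tc _] := wall_group_subgroup.
have [|w Tw wmax] := @argmax_group wall_group (fun g => ip x0 (g z))
    (sub_finite_set wall_group_sub W_finite).
  by exists \1%VF.
exists w => //; apply: walls_suffice => a wa.
have := wmax _ (Tc _ _ (wall_group_refl wa) Tw).
have [[_ a0] _] := wa; rewrite lfunE /= reflE ipDr ipNr ipZr gerBl.
by rewrite pmulr_lge0// pmulr_rge0.
Qed.

Lemma generic_mirror_point b : posroot b -> exists2 p, ip p b = 0 &
  forall a, posroot a -> a <> b -> ip p a != 0.
Proof.
move=> pb; have [P PE] := posroots_seq; have [[b1 _] _] := pb.
have [A|p] := @vspace_avoid _ _ (orthov ip <[b]>%VS)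
    [seq orthov ip <[a]>%VS | a <- P & a != b].
  case/mapP=> a; rewrite mem_filter => /andP[/eqP ab /PE pa] ->.
  have [[a1 _] _] := pa; apply/negP => /subvP sub.
  (* The projection u of a to the mirror of b would be orthogonal to a, hence zero, and a would be b
     or - b. *)
  pose u := a - ip a b *: b.
  have ub : ip u b = 0 by rewrite ipDl ipNl ipZl b1 mulr1 subrr.
  have ua : ip u a = 0.
    by apply/eqP; rewrite -mem_orthov1 sub// mem_orthov1; apply/eqP.
  have : ip u u = 0 by rewrite {2}/u ipDr ipNr ipZr ub ua mulr0 subrr.
  move/eqP; rewrite ip_eq0 subr_eq0 => /eqP e.
  have : ip a b ^+ 2 = 1 by rewrite -[RHS]a1 {2 3}e ipZl ipZr b1; ring.
  move/eqP; rewrite sqrf_eq1 => /orP[]/eqP c.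
    by apply: ab; rewrite e c scale1r.
  by have := posroot_notN pb; rewrite -scaleN1r -c -e.
rewrite mem_orthov1 => /eqP pb0 pP; exists p => // a pa /eqP ab.
rewrite -mem_orthov1; apply: pP; apply/mapP; exists a => //.
by rewrite mem_filter ab; exact/PE.
Qed.

(** Move a generic point p of the mirror of b into the closed chamber by some w in the wall group.
    Then w p lies on the mirror of w b only, so w b or its opposite is a wall root, and the
    reflection in b is conjugate to a wall reflection. *)
Lemma root_wall_group b : unit_root b -> wall_group (refl ip b).
Proof.
move=> rb; wlog pb : b rb / posroot b.
  move=> hw; have [/hw|/hw] := posrootVN rb; first exact.
  by rewrite reflN; apply; exact: rootN.
have [p pb0 pgen] := generic_mirror_point pb.
have [w Tw wp] := dominant_wall_group p; have Ww := wall_group_sub Tw.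
have ow := W_orth Ww.
have [_ _ Tc Tv] := wall_group_subgroup.
suff Trwb : wall_group (refl ip (w b)).
  have -> : refl ip b = ((w^-1 \o refl ip (w b)) \o w)%VF.
    by rewrite -comp_lfunA refl_conj// lker0_compKf// (orthogonal_lker0 ow).
  by apply: (Tc) => //; apply: (Tc) => //; exact: Tv.
have wpgen c : posroot c -> c <> w b -> c <> - w b -> 0 < ip (w p) c.
  move=> pc cb cNb; rewrite lt_neqAle wp// andbT eq_sym.
  rewrite (ip_orthogonalV _ _ ow); set d := (w^-1)%VF c.
  have rd : unit_root d by apply: root_act => //; [exact: W_inv|case: pc].
  have cd : c = w d by rewrite /d (orthogonalVK ow).
  have [pd|pd] := posrootVN rd.
    by apply: pgen => // db; apply: cb; rewrite cd db.
  rewrite -[d]opprK ipNr oppr_eq0; apply: pgen => // db; apply: cNb.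
  by rewrite cd -db linearN opprK.
have wpb : ip (w p) (w b) = 0 by rewrite ow.
have [pwb|pwb] := posrootVN (root_act Ww rb).
  apply: wall_group_refl; split=> //; exists (w p) => // c pc cb.
  by apply: wpgen => // cNb; apply: (posroot_notN pwb); rewrite -cNb.
rewrite -reflN; apply: wall_group_refl; split=> //.
exists (w p) => [|c pc cb]; first by rewrite ipNr wpb oppr0.
apply: wpgen => // cwb; apply: (posroot_notN pwb).
by rewrite opprK -cwb.
Qed.

(** * Words in wall reflections and simple transitivity on chambers *)

Fixpoint word_prod l : 'End(V) :=
  if l is a :: l' then (refl ip a \o word_prod l')%VF else \1%VF.

Lemma word_prod_cat l1 l2 :
  word_prod (l1 ++ l2) = (word_prod l1 \o word_prod l2)%VF.
Proof. by elim: l1 => [|a l1 IH] /=; rewrite ?comp_lfun1l// IH comp_lfunA. Qed.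

Definition wall_word l := forall a, a \in l -> wallroot a.

Lemma word_prod_W l : wall_word l -> W (word_prod l).
Proof.
elim: l => [|a l IH] lw /=; first by case: W_group.
apply: W_comp; last by apply: IH => b bl; apply: lw; rewrite inE bl orbT.
by have [[[_ Wa] _] _] := lw a (mem_head _ _).
Qed.

Lemma word_prod_rev l : wall_word l -> (word_prod (rev l) \o word_prod l)%VF = \1%VF.
Proof.
elim: l => [|a l IH] lw; first by rewrite /= comp_lfun1l.
have [[[a1 _] _] _] := lw a (mem_head _ _).
rewrite rev_cons -cats1 word_prod_cat /= comp_lfun1r comp_lfunA.
rewrite -[((word_prod _ \o refl ip a) \o refl ip a)%VF]comp_lfunA refl_comp// comp_lfun1r.
by apply: IH => b bl; apply: lw; rewrite inE bl orbT.
Qed.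

Lemma wall_groupP g : wall_group g -> exists2 l, wall_word l & g = word_prod l.
Proof.
pose T := [set g | exists2 l, wall_word l & g = word_prod l].
apply: (smallest_sub (X := T)) => [|_ [a wa <-]]; last first.
  exists [:: a] => [b|]; first by rewrite inE => /eqP ->.
  by rewrite /= comp_lfun1r.
split=> [_ [l lw ->]||_ _ [l lw ->] [m mw ->]|_ [l lw ->]].
- exact/W_orth/word_prod_W.
- by exists [::].
- exists (l ++ m); last by rewrite word_prod_cat.
  by move=> b; rewrite mem_cat => /orP[/lw|/mw].
- exists (rev l) => [b|]; first by rewrite mem_rev => /lw.
  have lk := orthogonal_lker0 (W_orth (word_prod_W lw)).
  by rewrite -[RHS](lker0_compfK lk) word_prod_rev// comp_lfun1l.
Qed.

(** Some letter, read from the right, is the first to turn the running root negative; by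
    [wallroot_permutes] that root is the letter itself. *)
Lemma word_prod_first_negative l a : wall_word l -> wallroot a ->
  posroot (- word_prod l a) ->
  exists l1 b l2, l = l1 ++ b :: l2 /\ word_prod l2 a = b.
Proof.
move=> + wa; elim: l => [|b l IH] lw /=.
  by rewrite lfunE /= => /posroot_notN; rewrite opprK; case; case: wa.
have lw' : wall_word l by move=> c cl; apply: lw; rewrite inE cl orbT.
have [pa _] := wa.
have [pc|pc] := posrootVN (root_act (word_prod_W lw') pa.1); last first.
  move=> _; have [l1 [c [l2 [-> <-]]]] := IH lw' pc.
  by exists (b :: l1), (word_prod l2 a), l2.
rewrite lfunE /= => pN; exists [::], b, l; split=> //.
have [//|/eqP cb] := eqVneq (word_prod l a) b.
by have := posroot_notN (wallroot_permutes (lw b (mem_head _ _)) pc cb).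
Qed.

(* Deletion: read from the right, such a word first turns its last root [a]
   negative at a letter [b] with [word_prod l2 a = b]; both can be cancelled. *)
Lemma word_prod_positive l : wall_word l ->
  (forall b, posroot b -> posroot (word_prod l b)) -> word_prod l = \1%VF.
Proof.
have [n] := ubnP (size l); elim: n l => [//|n IH] l ln.
case/lastP: l ln => [//|l a]; rewrite size_rcons -cats1 => ln lw pl.
have wa : wallroot a by apply: lw; rewrite mem_cat mem_head orbT.
have lw' : wall_word l by move=> c cl; apply: lw; rewrite mem_cat cl.
have [[[a1 _] _] _] := wa.
have [|l1 [b [l2 [lE ba]]]] := word_prod_first_negative lw' wa.
  have := pl a wa.1; rewrite word_prod_cat /= comp_lfun1r lfunE /= refl_normal//.
  by rewrite linearN.
have l2w : wall_word l2 by move=> c cl; apply: lw'; rewrite lE mem_cat inE cl !orbT.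
have l1w : wall_word l1 by move=> c cl; apply: lw'; rewrite lE mem_cat cl.
have e : word_prod (l ++ [:: a]) = word_prod (l1 ++ l2).
  rewrite lE !word_prod_cat /= comp_lfun1r -!comp_lfunA; congr (_ \o _)%VF.
  rewrite -ba comp_lfunA refl_conj; last exact/W_orth/word_prod_W.
  by rewrite -comp_lfunA refl_comp// comp_lfun1r.
rewrite e; apply: IH => [|c|c pc].
- by move: ln; rewrite lE !size_cat /=; lia.
- by rewrite mem_cat => /orP[/l1w|/l2w].
- by rewrite -e; exact: pl.
Qed.

Hypothesis W_generated : forall T, orthogonal_subgroup ip T ->
  (forall a, unit_root a -> T (refl ip a)) -> W `<=` T.

Lemma W_wall_group : W = wall_group.
Proof.
apply/seteqP; split; last exact: wall_group_sub.
exact: W_generated wall_group_subgroup root_wall_group.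
Qed.

Definition in_chamber x := forall a, posroot a -> 0 < ip x a.

(** Such a g maps positive roots to positive roots, because ip (g y) (g b) = ip y b > 0; deletion
    then reduces its word to the empty one. *)
Lemma chamber_simply_transitive g y : W g -> in_chamber y -> in_chamber (g y) ->
  g = \1%VF.
Proof.
move=> Wg yC gyC; have := Wg; rewrite W_wall_group => /wall_groupP[l lw gE].
rewrite gE; apply: word_prod_positive => // b pb; rewrite -gE.
have [//|pN] := posrootVN (root_act Wg pb.1).
have := gyC _ pN; rewrite ipNr (W_orth Wg) oppr_gt0 => h.
by have := yC _ pb => /(lt_trans h); rewrite ltxx.
Qed.

Lemma argmax_dominant x y g : in_chamber x -> W g ->
  (forall h, W h -> ip x (h y) <= ip x (g y)) -> dominant (g y).
Proof.
move=> xC Wg gmax a pa.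
have := gmax _ (W_comp pa.1.2 Wg); rewrite lfunE /= reflE ipDr ipNr ipZr gerBl.
by rewrite pmulr_lge0 ?xC// pmulr_rge0.
Qed.

Lemma dominant_representative y : exists2 g, W g & dominant (g y).
Proof.
have x0C : in_chamber x0 by move=> a [].
have [|g Wg gmax] := @argmax_group W (fun g => ip x0 (g y)) W_finite.
  by exists \1%VF; case: W_group.
by exists g => //; exact: argmax_dominant gmax.
Qed.

(** A maximizing h makes h y dominant, hence in the open chamber since y lies on no mirror; so h =
    1. *)
Lemma in_chamber_ip_max x y g : in_chamber x -> in_chamber y -> W g ->
  ip x (g y) <= ip x y.
Proof.
move=> xC yC Wg; have [|h Wh hmax] := @argmax_group W (fun g => ip x (g y)) W_finite.
  by exists \1%VF; case: W_group.
have dhy := argmax_dominant xC Wh hmax.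
have hyC : in_chamber (h y).
  move=> a pa; rewrite lt_neqAle dhy// andbT eq_sym.
  rewrite (ip_orthogonalV _ _ (W_orth Wh)).
  have [pc|pc] := posrootVN (root_act (W_inv Wh) pa.1).
    by rewrite gt_eqF// yC.
  by have := yC _ pc; rewrite ipNr oppr_gt0 => /ltr0_neq0.
have := hmax g Wg.
by rewrite (chamber_simply_transitive Wh yC hyC) [X in _ <= ip x X -> _]lfunE.
Qed.

(** Push x and y into the open chamber by t x0 and let t tend to 0. This makes the closed chamber
    isometric to V / W. *)
Lemma dominant_ip_max x y g : dominant x -> dominant y -> W g ->
  ip x (g y) <= ip x y.
Proof.
move=> xC yC Wg.
have shift z t : dominant z -> 0 < t -> in_chamber (z + t *: x0).
  by move=> zC t0 a pa; rewrite ipDl ipZl ltr_wpDl ?zC// mulr_gt0//; case: pa.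
pose A := ip x y - ip x (g y).
pose B := ip x x0 + ip x0 y - ip x (g x0) - ip x0 (g y).
pose C := ip x0 x0 - ip x0 (g x0).
have quad t : 0 < t -> 0 <= A + t * (B + t * C).
  move=> t0; have := in_chamber_ip_max (shift x t xC t0) (shift y t yC t0) Wg.
  rewrite linearD /= [g (_ *: _)]linearZ /= !(ipE ip) => h.
  rewrite /A /B /C; lra.
rewrite leNgt; apply/negP => lt; have A0 : A < 0 by rewrite /A subr_lt0.
(* For t <= 1 the factor B + t * C is at most M, and t <= - A / (2 * M) leaves A + t * M <= A / 2 <
   0. *)
pose M := `|B| + `|C| + 1; have M1 : 1 <= M by rewrite lerDr addr_ge0.
pose t := Num.min 1 (- A / (2 * M)).
have t0 : 0 < t by rewrite lt_min ltr01 divr_gt0 ?oppr_gt0 ?mulr_gt0//; lra.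
have t1 : t <= 1 by rewrite ge_min lexx.
have tM : t * (2 * M) <= - A.
  by rewrite -ler_pdivlMr ?ge_min ?lexx ?orbT// mulr_gt0//; lra.
have := quad t t0; have : t * (B + t * C) <= t * M.
  rewrite ler_wpM2l ?ltW//.
  have tC : t * C <= `|C|.
    apply: le_trans (ler_norm _) _; rewrite normrM (ger0_norm (ltW t0)).
    by rewrite ler_piMl.
  have := ler_norm B; rewrite /M => ?; lra.
move=> ? ?; lra.
Qed.

End RootSystem.

(** * The upper bound *)

Section OrbitDistance.
Context {R : realType} {V : vectType R} (ip : {dot V for @idfun R}).
Variable G : set 'End(V).
Implicit Types A B : orbit_space G.

Lemma ipdist_ge0 x y : 0 <= ipdist ip x y.
Proof. exact: sqrtr_ge0. Qed.

Lemma orbit_dist_le A B p q : sval A p -> sval B q ->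
  orbit_dist ip A B <= ipdist ip p q.
Proof.
move=> Ap Bq; apply: ge_inf; last by exists p => //; exists q.
by exists 0 => _ [x _] [y _ <-]; exact: ipdist_ge0.
Qed.

Lemma orbit_nonempty A : G \1%VF -> sval A !=set0.
Proof.
move=> G1; have [x _ <-] := svalP A.
by exists x; exists \1%VF; rewrite ?lfunE.
Qed.

Lemma orbit_dist_ge A B m : G \1%VF ->
  (forall p q, sval A p -> sval B q -> m <= ipdist ip p q) -> m <= orbit_dist ip A B.
Proof.
move=> G1 h; apply: lb_le_inf => [|_ [p Ap] [q Bq <-]]; last exact: h.
have [p Ap] := orbit_nonempty A G1; have [q Bq] := orbit_nonempty B G1.
by exists (ipdist ip p q); exists p => //; exists q.
Qed.

End OrbitDistance.

Section AlternatingQuotientEmbedding.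
Context {R : realType} {V : vectType R} (ip : {dot V for @idfun R}).
Variable W : set 'End(V).
Implicit Types (a b x y z p : V) (g h : 'End(V)).
Hypothesis W_group : orthogonal_subgroup ip W.
Hypothesis W_finite : finite_set W.
Variable x0 : V.
Hypothesis x0_regular : forall a, unit_root ip W a -> ip x0 a != 0.
Hypothesis W_generated : forall T, orthogonal_subgroup ip T ->
  (forall a, unit_root ip W a -> T (refl ip a)) -> W `<=` T.

Let W_orth g : W g -> orthogonal_maps ip g.
Proof. by case: W_group => + _ _ _; exact. Qed.

Let W_id : W \1%VF. Proof. by case: W_group. Qed.

Let W_comp g h : W g -> W h -> W (g \o h)%VF.
Proof. by case: W_group => _ _ + _; exact. Qed.

Let W_inv g : W g -> W (g^-1)%VF.
Proof. by case: W_group => _ _ _; exact. Qed.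

Lemma lfun_detV g : orthogonal_maps ip g -> lfun_det g * lfun_det (g^-1)%VF = 1.
Proof.
by move=> /orthogonal_lker0 lk; rewrite -lfun_det_comp lker0_compfV// lfun_det1.
Qed.

Lemma lfun_det_sign g : W g -> lfun_det g = 1 \/ lfun_det g = -1.
Proof.
pose T := [set g | orthogonal_maps ip g /\ (lfun_det g = 1 \/ lfun_det g = -1)].
move=> Wg; suff [] : T g by [].
apply: (W_generated (T := T)) Wg; last first.
  by move=> a [a1 _]; split; [exact: refl_orthogonal|right; exact: det_refl].
have [Oo O1 Oc Ov] := orthogonal_subgroup_full ip.
split=> [g' []//||g' h [og dg] [oh dh]|g' [og dg]].
- by split=> //; left; exact: lfun_det1.
- split; first exact: Oc.
  by rewrite lfun_det_comp; case: dg => ->; case: dh => ->;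
    rewrite ?mulrNN ?mul1r ?mulr1; [left|right|right|left].
- split; first exact: Ov.
  by have := lfun_detV og; case: dg => ->; rewrite ?mul1r ?mulN1r => e;
    [left|right; rewrite -e opprK].
Qed.

Lemma unit_root_of_det g : W g -> lfun_det g = -1 -> exists a, unit_root ip W a.
Proof.
move=> Wg dg; apply: contrapT => noroot.
have : [set \1%VF] g.
  apply: (W_generated (T := [set \1%VF])) Wg => [|a ra]; last first.
    by case: noroot; exists a.
  split=> [_ -> x y||_ _ -> ->|_ ->]; rewrite ?lfunE ?comp_lfun1l//=.
  have lk : lker (\1%VF : 'End(V)) == 0%VS by apply/lker0P => x y; rewrite !lfunE.
  by rewrite -[LHS]comp_lfun1l lker0_compfV.
by move=> g1; move: dg; rewrite g1 lfun_det1 => ?; lra.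
Qed.

(** The minimum of |ip x a| over the finitely many positive roots; with no roots it is set to 0, so
    that trivial W needs no separate embedding. *)
Lemma exists_mirror_distance : exists d : V -> R,
  [/\ forall x, 0 <= d x,
      forall x a, unit_root ip W a -> d x <= `|ip x a|,
      forall x a, unit_root ip W a ->
        exists2 b, posroot ip W x0 b & d x = `|ip x b| &
      (forall a, ~ unit_root ip W a) -> forall x, d x = 0].
Proof.
have [P PE] := posroots_seq ip W_finite x0.
have pos a : unit_root ip W a -> posroot ip W x0 a \/ posroot ip W x0 (- a).
  exact: posrootVN.
have [P0|Pn0] := eqVneq P [::].
  have nr a : ~ unit_root ip W a.
    by move=> /pos[]/PE; rewrite P0 in_nil.
  by exists (fun=> 0); split=> // x a /nr.
have [f fP] : {f : V -> V & forall x, f x \in P /\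
    forall y, y \in P -> `|ip x (f x)| <= `|ip x y|}.
  apply: (@choice _ _ (fun x b => b \in P /\ forall y, y \in P -> `|ip x b| <= `|ip x y|)) => x.
  by have [b bP bmin] := seq_argmin (fun b => `|ip x b|) Pn0; exists b.
exists (fun x => `|ip x (f x)|); split=> // [x a|x a _|nr x].
- move=> /pos[|] /PE aP; first exact: (fP x).2.
  by rewrite -[leRHS]normrN -ipNr; exact: (fP x).2.
- by exists (f x) => //; apply/PE; exact: (fP x).1.
- by have /PE[/nr] := (fP x).1.
Qed.

Section MirrorDistance.
Variable d : V -> R.
Hypothesis d_ge0 : forall x, 0 <= d x.
Hypothesis d_le : forall x a, unit_root ip W a -> d x <= `|ip x a|.
Hypothesis d_attained : forall x a, unit_root ip W a ->
  exists2 b, posroot ip W x0 b & d x = `|ip x b|.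
Hypothesis d_trivial : (forall a, ~ unit_root ip W a) -> forall x, d x = 0.

Local Notation dominant := (dominant ip W x0).

Lemma mirror_distance_invariant g x : W g -> d (g x) = d x.
Proof.
have le h y : W h -> d (h y) <= d y.
  move=> Wh; have [[a ra]|nr] := pselect (exists a, unit_root ip W a).
    have [b [rb _] ->] := d_attained y ra.
    by rewrite -(W_orth Wh); apply: d_le; exact: root_act.
  by rewrite !d_trivial// => a ra; apply: nr; exists a.
move=> Wg; apply/le_anti; rewrite le//=.
by rewrite -{1}(orthogonalK (W_orth Wg) x) le//; exact: W_inv.
Qed.

Lemma mirror_distance_lipschitz x y : d x - d y <= ipnorm ip (x - y).
Proof.
have [[a ra]|nr] := pselect (exists a, unit_root ip W a); last first.
  rewrite !d_trivial ?subr0 ?ipnorm_ge0// => a ra; by apply: nr; exists a.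
have [b [rb _] ->] := d_attained y ra; have [b1 _] := rb.
rewrite lerBlDr; apply: le_trans (d_le x rb) _.
rewrite -{1}(subrK y x) ipDl; apply: le_trans (ler_normD _ _) _.
rewrite lerD2r ler_norml lerNl -ipNl.
have bn : ipnorm ip b = 1 by rewrite /ipnorm b1 sqrtr1.
have := ip_le_norm ip (x - y) b; have := ip_le_norm ip (- (x - y)) b.
rewrite opprB (ipnormB ip y) bn mulr1 => -> ->.
by [].
Qed.

(** If some mirror separates x from h y, the distances of both points to it add up. Otherwise y and
    h y lie in the open chamber, so h = 1, which is not odd. *)
Lemma mirror_distance_odd x y h : dominant x -> dominant y -> W h ->
  lfun_det h = -1 -> d x + d y <= ipnorm ip (x - h y).
Proof.
move=> dx dy Wh dh; rewrite -(mirror_distance_invariant y Wh).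
have [[a pa ha]|noa] := pselect (exists2 a, posroot ip W x0 a & ip (h y) a <= 0).
  have [[a1 Wa] _] := pa.
  have an : ipnorm ip a = 1 by rewrite /ipnorm a1 sqrtr1.
  have := ip_le_norm ip (x - h y) a; rewrite an mulr1; apply: le_trans.
  rewrite ipDl ipNl lerD//.
    by rewrite -(ger0_norm (dx _ pa)); apply: d_le; exact: pa.1.
  by rewrite -(ler0_norm ha); apply: d_le; exact: pa.1.
have hyC : in_chamber ip W x0 (h y).
  by move=> a pa; rewrite ltNge; apply/negP => ha; apply: noa; exists a.
have yC : in_chamber ip W x0 y.
  move=> a pa; rewrite lt_neqAle dy// andbT eq_sym -(W_orth Wh).
  have [pha|pha] := posrootVN x0_regular (root_act W_group Wh pa.1).
    by rewrite gt_eqF// hyC.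
  by have := hyC _ pha; rewrite ipNr oppr_gt0 => /ltr0_neq0.
have h1 := chamber_simply_transitive W_group W_finite x0_regular W_generated Wh yC hyC.
by move: dh; rewrite h1 lfun_det1 => ?; lra.
Qed.

Lemma dominant_norm_le x y h : dominant x -> dominant y -> W h ->
  ip (x - y) (x - y) <= ip (x - h y) (x - h y).
Proof.
move=> dx dy Wh.
have := dominant_ip_max W_group W_finite x0_regular W_generated dx dy Wh.
rewrite !(ipE ip) (W_orth Wh) (ipC ip y x) (ipC ip (h y) x) => ?; lra.
Qed.

(** Each summand is at most ip (x - h y) (x - h y): the first by dominance, the second because d is
    1-Lipschitz when the signs agree and by [mirror_distance_odd] when they differ. *)
Lemma fold_upper x y (e1 e2 : R) h : dominant x -> dominant y -> W h ->
  (e1 = 1 \/ e1 = -1) -> (e2 = 1 \/ e2 = -1) -> lfun_det h = e1 * e2 ->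
  ip (x - y) (x - y) + (e1 * d x - e2 * d y) ^+ 2 <= 2 * ip (x - h y) (x - h y).
Proof.
move=> dx dy Wh e1s e2s dh; have le1 := dominant_norm_le dx dy Wh.
suff : (e1 * d x - e2 * d y) ^+ 2 <= ip (x - h y) (x - h y) by lra.
rewrite -sqr_ipnorm; set D := ipnorm _ _; have D0 : 0 <= D := ipnorm_ge0 _ _.
have same : `|d x - d y| <= D.
  rewrite ler_norml lerNl opprB -(mirror_distance_invariant y Wh).
  by rewrite /D {1}ipnormB !mirror_distance_lipschitz.
have odd : lfun_det h = -1 -> `|d x + d y| <= D.
  by move=> h1; rewrite ger0_norm ?addr_ge0//; exact: mirror_distance_odd.
have sq u : `|u| <= D -> u ^+ 2 <= D ^+ 2.
  by move=> uD; rewrite -real_normK ?num_real// ler_pXn2r.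
case: e1s e2s dh => -> [] -> dh; rewrite ?mul1r ?mulN1r ?opprK in dh *.
- exact: sq.
- exact/sq/odd.
- rewrite -opprD sqrrN; exact/sq/odd.
- by rewrite -sqrrN opprD opprK; exact: sq.
Qed.

(** The witness is the reflection in the mirror nearest to whichever point has the smaller d;
    exchanging the points replaces h by its inverse. *)
Lemma fold_lower_odd x y g : dominant x -> dominant y -> W g -> lfun_det g = -1 ->
  exists h, [/\ W h, lfun_det h = -1 &
    ip (x - h y) (x - h y) <= 2 * (ip (x - y) (x - y) + (d x + d y) ^+ 2)].
Proof.
move=> + + Wg dg; have [a ra] := unit_root_of_det Wg dg.
wlog dxy : x y / d x <= d y.
  move=> hw dx dy; have [le|/ltW le] := leP (d x) (d y); first exact: hw.
  have [h [Wh dh hle]] := hw _ _ le dy dx; exists (h^-1)%VF; split.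
  - exact: W_inv.
  - by have := lfun_detV (W_orth Wh); rewrite dh mulN1r => <-; rewrite opprK.
  - have ipB u v : ip (u - v) (u - v) = ip (v - u) (v - u).
      by rewrite -opprB ipNl ipNr opprK.
    rewrite -(W_orth Wh) linearB /= (orthogonalVK (W_orth Wh)).
    by rewrite (ipB (h x)) (ipB x) (addrC (d x)).
move=> dx dy; have [b pb db] := d_attained x ra.
have [[b1 Wb] _] := pb; exists (refl ip b); split; rewrite ?det_refl//.
rewrite ger0_norm ?dx// in db.
have dyb : d y <= ip y b by rewrite -(ger0_norm (dy _ pb)); apply: d_le; exact: pb.1.
have sqb : (ip y b - ip x b) ^+ 2 <= ip (x - y) (x - y).
  by have := cauchy_schwarz ip (x - y) b; rewrite b1 mulr1 ipDl ipNl -opprB sqrrN.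
have -> : ip (x - refl ip b y) (x - refl ip b y) =
    ip (x - y) (x - y) + 4 * (ip x b * ip y b).
  rewrite reflE !(ipE ip) b1 (ipC ip y x) (ipC ip b x) (ipC ip b y); ring.
rewrite db; move: dyb sqb (d_ge0 x) dxy; rewrite db.
move: (ip x b) (ip y b) (d y) (ip (x - y) (x - y)) => p q s D sq D2 p0 ps.
(* The goal amounts to 4 p q <= D + 2 (p + s)^2. This square says 4 p q <= (q - p)^2 + 8 p^2, where
   (q - p)^2 <= D and (2 p)^2 <= (p + s)^2. *)
have : 0 <= (q - p - 2 * p) ^+ 2 by exact: sqr_ge0.
have : (2 * p) ^+ 2 <= (p + s) ^+ 2 by rewrite ler_pXn2r ?nnegrE//; lra.
move=> ? ?; lra.
Qed.

End MirrorDistance.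

(** The sheet of the orbit is the determinant of the element u that folds x into the closed chamber.
    Both signs can occur only on a mirror, where d vanishes. *)
Lemma orbit_representative (A : orbit_space (alternating_subgroup W)) :
  exists x u e, [/\ W u /\ lfun_det u = e, e = 1 \/ e = -1,
    dominant ip W x0 (u x) & sval A = group_orbit (alternating_subgroup W) x].
Proof.
have [x _ xA] := svalP A.
have [u Wu du] := dominant_representative W_group W_finite x0 x.
by exists x, u, (lfun_det u); split=> //; exact: lfun_det_sign.
Qed.

Lemma alternating_subgroup1 : alternating_subgroup W \1%VF.
Proof. by split; [exact: W_id|exact: lfun_det1]. Qed.

Section OrbitPairs.
Variables (x y : V) (u v : 'End(V)) (e1 e2 : R).
Hypotheses (Wu : W u) (Wv : W v) (du : lfun_det u = e1) (dv : lfun_det v = e2).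
Hypotheses (e1s : e1 = 1 \/ e1 = -1) (e2s : e2 = 1 \/ e2 = -1).
Local Notation orbit := (group_orbit (alternating_subgroup W)).

(** With [orbit_pair_witness], this turns the orbit distance into the infimum of |u x - h (v y)|
    over h in W of determinant e1 * e2. *)
Lemma orbit_pair_lift p q : orbit x p -> orbit y q ->
  exists h, [/\ W h, lfun_det h = e1 * e2 &
    ipdist ip p q = ipnorm ip (u x - h (v y))].
Proof.
move=> [g1 [W1 d1] <-] [g2 [W2 d2] <-].
have [ o1 o2 ou ov] : [/\ orthogonal_maps ip g1, orthogonal_maps ip g2,
  orthogonal_maps ip u & orthogonal_maps ip v] by split; exact: W_orth.
exists ((u \o g1^-1) \o (g2 \o v^-1))%VF; split.
- by do !apply: W_comp => //; exact: W_inv.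
- rewrite !lfun_det_comp du (_ : lfun_det g2 = 1)//.
  have := lfun_detV o1; rewrite (_ : lfun_det g1 = 1)// mul1r => ->.
  have := lfun_detV ov; rewrite dv.
  move=> h; have -> : lfun_det (v^-1)%VF = e2 by case: e2s h => ->; lra.
  by rewrite mulr1 mul1r.
- rewrite !lfunE /= !lfunE /= (orthogonalK ov) /ipdist /ipnorm.
  have -> : u x - u ((g1^-1)%VF (g2 y)) = (u \o g1^-1)%VF (g1 x - g2 y).
    by rewrite lfunE /= !linearB /= (orthogonalK o1).
  by rewrite lfunE /= ou (orthogonalV o1).
Qed.

Lemma orbit_pair_witness h : W h -> lfun_det h = e1 * e2 ->
  exists p q, [/\ orbit x p, orbit y q & ipdist ip p q = ipnorm ip (u x - h (v y))].
Proof.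
move=> Wh dh; have ou := W_orth Wu.
exists x, ((u^-1 \o (h \o v))%VF y); split.
- by exists \1%VF; [exact: alternating_subgroup1|rewrite lfunE].
- exists (u^-1 \o (h \o v))%VF => //; split.
    by do !apply: W_comp => //; exact: W_inv.
  rewrite -[\det _]/(lfun_det _) !lfun_det_comp dh dv.
  have := lfun_detV ou; rewrite du.
  by case: e1s => ->; case: e2s => ->; lra.
- rewrite /ipdist /ipnorm -ou linearB /= !lfunE /= (orthogonalVK ou).
  by rewrite lfunE.
Qed.

End OrbitPairs.

Definition frame_embedding (fr : seq V) (x : V) (t : R) : euc R (size fr).+1 :=
  \row_i (if (i < size fr)%N then ip x fr`_i else t).

Lemma frame_embedding_dist fr x y t s : (forall z, frame ip fr z) ->
  `|frame_embedding fr x t - frame_embedding fr y s| ^+ 2 =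
  ip (x - y) (x - y) + (t - s) ^+ 2.
Proof.
move=> frP; rewrite euc_normE sqr_ipnorm /= /eucdot big_ord_recr /=.
rewrite !mxE /= ltnn -expr2; congr (_ + _).
rewrite (frame_norm (frP _)) (big_nth 0) big_mkord; apply: eq_bigr => i _.
by rewrite !mxE /= ltn_ord ipDl ipNl -expr2.
Qed.

Theorem euclidean_distortion_le2 :
  (euclidean_distortion (@orbit_dist R V ip (alternating_subgroup W)) <= 2%:E)%E.
Proof.
rewrite /euclidean_distortion; case: ifP => _; first by rewrite lee_fin ler1n.
have [d [d_ge0 d_le d_att d_triv]] := exists_mirror_distance.
have [fr frP] := exists_frame ip.
have [rep repP] : {rep : orbit_space (alternating_subgroup W) -> V * 'End(V) * R &
    forall A, let: (x, u, e) := rep A in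
      [/\ W u /\ lfun_det u = e, e = 1 \/ e = -1,
      dominant ip W x0 (u x) & sval A = group_orbit (alternating_subgroup W) x]}.
  apply: (@choice _ _ (fun A (r : V * 'End(V) * R) => let: (x, u, e) := r in
      [/\ W u /\ lfun_det u = e, e = 1 \/ e = -1,
      dominant ip W x0 (u x) & sval A = group_orbit (alternating_subgroup W) x])) => A.
  by have [x [u [e h]]] := orbit_representative A; exists (x, u, e).
pose f A := let: (x, u, e) := rep A in frame_embedding fr (u x) (e * d (u x)).
apply: (@le_trans _ _ (distortion (@orbit_dist R V ip (alternating_subgroup W))
    (fun a b : euc R (size fr).+1 => `|a - b|) f)).
  apply: ereal_inf_lbound; exists (euc R (size fr).+1), eucdot_dot.
  by split=> [a|]; [rewrite euc_normE sqr_ipnorm|exists f].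
have s0 : 0 < Num.sqrt 2 :> R by rewrite sqrtr_gt0.
have ss : Num.sqrt 2 * Num.sqrt 2 = 2 :> R by rewrite -expr2 sqr_sqrtr.
have -> : 2 = Num.sqrt 2 / (Num.sqrt 2)^-1 :> R by rewrite invrK.
apply: distortion_le; rewrite ?invr_gt0 ?sqrtr_ge0// => A B; last first.
  rewrite mulrC -ler_pdivrMr//; apply: orbit_dist_ge => [|p q Ap Bq].
    exact: alternating_subgroup1.
  rewrite ler_pdivrMr//; move: (repP A) (repP B); rewrite /f.
  case: (rep A) => -[x u] e1; case: (rep B) => -[y v] e2.
  move=> [[Wu du] e1s dx xA] [[Wv dv] e2s dy yB].
  have [||h [Wh dh ->]] := orbit_pair_lift Wu Wv du dv e2s (p := p) (q := q) (x := x) (y := y).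
  - by rewrite -xA.
  - by rewrite -yB.
  rewrite -(@ler_pXn2r _ 2)// ?nnegrE ?mulr_ge0 ?ipnorm_ge0 ?sqrtr_ge0//.
  rewrite frame_embedding_dist// exprMn sqr_ipnorm sqr_sqrtr// [leRHS]mulrC.
  exact: (fold_upper d_ge0 d_le d_att d_triv).
rewrite mulrC ler_pdivrMr//.
suff [p [q [Ap Bq h]]] : exists p q, [/\ sval A p, sval B q &
    ipdist ip p q <= `|f A - f B| * Num.sqrt 2].
  exact: le_trans (orbit_dist_le _ Ap Bq) h.
move: (repP A) (repP B); rewrite /f.
case: (rep A) => -[x u] e1; case: (rep B) => -[y v] e2.
move=> [[Wu du] e1s dx xA] [[Wv dv] e2s dy yB].
suff [h [Wh dh hle]] : exists h, [/\ W h, lfun_det h = e1 * e2 &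
    ip (u x - h (v y)) (u x - h (v y)) <=
    2 * (ip (u x - v y) (u x - v y) + (e1 * d (u x) - e2 * d (v y)) ^+ 2)].
  have [p [q [xp yq e]]] := orbit_pair_witness x y Wu Wv du dv e1s e2s Wh dh.
  exists p, q; rewrite xA yB; split=> //; rewrite e.
  rewrite -(@ler_pXn2r _ 2)// ?nnegrE ?mulr_ge0 ?ipnorm_ge0 ?sqrtr_ge0//.
  by rewrite exprMn frame_embedding_dist// sqr_ipnorm sqr_sqrtr// [leRHS]mulrC.
have same : e1 * e2 = 1 -> exists h, [/\ W h, lfun_det h = e1 * e2 &
    ip (u x - h (v y)) (u x - h (v y)) <=
    2 * (ip (u x - v y) (u x - v y) + (e1 * d (u x) - e2 * d (v y)) ^+ 2)].
  move=> e12; exists \1%VF; split; rewrite ?e12 ?lfun_det1 ?lfunE//=.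
  have := ip_ge0 ip (u x - v y); have := sqr_ge0 (e1 * d (u x) - e2 * d (v y)).
  by move=> ? ?; lra.
have oddc (g : 'End(V)) s : W g -> lfun_det g = -1 -> s ^+ 2 = (d (u x) + d (v y)) ^+ 2 ->
    exists h, [/\ W h, lfun_det h = -1 &
    ip (u x - h (v y)) (u x - h (v y)) <=
    2 * (ip (u x - v y) (u x - v y) + s ^+ 2)].
  by move=> Wg dg ->; exact: (fold_lower_odd d_ge0 d_le d_att dx dy Wg dg).
(* On one sheet h = 1 works; on different sheets whichever of u, v has determinant -1 is the odd
   element that [fold_lower_odd] asks for. *)
case: e1s => e1E; case: e2s => e2E.
- by apply: same; rewrite e1E e2E mulr1.
- rewrite (_ : e1 * e2 = -1) ?e1E ?e2E ?mul1r//.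
  by apply: (oddc v); rewrite ?dv// mulN1r opprK.
- rewrite (_ : e1 * e2 = -1) ?e1E ?e2E ?mulr1//.
  by apply: (oddc u); rewrite ?du//; ring.
- by apply: same; rewrite e1E e2E mulrNN mulr1.
Qed.

End AlternatingQuotientEmbedding.

(** * Rotations of a plane and the lower bound *)

Section Angles.
Context {R : realType}.
Implicit Types t s : R.

Lemma exists_angle (c s : R) : c ^+ 2 + s ^+ 2 = 1 ->
  exists t, cos t = c /\ sin t = s.
Proof.
move=> cs; have c1 : -1 <= c <= 1.
  rewrite -ler_norml -(@ler_pXn2r _ 2)// ?nnegrE//.
  by rewrite real_normK ?num_real// expr1n -cs lerDl sqr_ge0.
have ca : cos (acos c) = c by rewrite acosK// in_itv.
have : sin (acos c) ^+ 2 = s ^+ 2 by rewrite sin2cos2 ca -cs; ring.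
move/eqP; rewrite eqf_sqr => /orP[]/eqP sa.
  by exists (acos c).
by exists (- acos c); rewrite cosN sinN ca sa opprK.
Qed.

Lemma cosDpi_nat t (k : nat) : cos (t + k%:R * (pi *+ 2)) = cos t.
Proof. by rewrite mulr_natl; exact: (periodicn (@cosD2pi R)). Qed.

Lemma sinDpi_nat t (k : nat) : sin (t + k%:R * (pi *+ 2)) = sin t.
Proof. by rewrite mulr_natl; exact: (periodicn (@sinD2pi R)). Qed.

(** Modulo 2 pi the angle t is 0 or at least th away from 0, so th / 2 + t stays at least th / 2
    away from 0. *)
Lemma cos_half_shift_le (th t : R) : 0 < th <= pi -> cos t = 1 \/ cos t <= cos th ->
  cos (th / 2 + t) <= cos (th / 2).
Proof.
move=> th0 ht; set h := th / 2; have p0 := pi_gt0 R.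
have ch : 0 <= cos h by apply: cos_ge0_pihalf; rewrite /h; lra.
have sh : 0 <= sin h by apply: sin_ge0_pi; rewrite /h; lra.
have thE : cos th = cos h ^+ 2 - sin h ^+ 2.
  have -> : th = h + h by rewrite /h; lra.
  by rewrite cosD -!expr2.
rewrite cosD; have := cos2Dsin2 t; have := cos2Dsin2 h; rewrite thE in ht.
move: (cos h) (sin h) (cos t) (sin t) ch sh ht => C S c s C0 S0 ht CS cs.
have c1 : c <= 1.
  rewrite leNgt; apply/negP => c1; have : 1 < c ^+ 2 by rewrite expr_gt1//; lra.
  have := sqr_ge0 s => ? ?; lra.
have cN1 : -1 <= c.
  rewrite leNgt; apply/negP => cN; have : 1 < (- c) ^+ 2 by rewrite expr_gt1//; lra.
  have := sqr_ge0 s; rewrite sqrrN => ? ?; lra.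
case: ht => [c_eq1|cle].
  have : s ^+ 2 = 0 by rewrite c_eq1 in cs; lra.
  by move/eqP; rewrite sqrf_eq0 => /eqP ->; rewrite c_eq1 mulr1 mulr0 subr0.
have [s0|s0] := lerP 0 s.
  have : 0 <= S * s by exact: mulr_ge0.
  have : 0 <= C * (1 - c) by rewrite mulr_ge0//; lra.
  move=> ? ?; lra.
suff : S * - s <= C * (1 - c) by lra.
have l0 : 0 <= S * - s by rewrite mulr_ge0//; lra.
have r0 : 0 <= C * (1 - c) by rewrite mulr_ge0//; lra.
(* After squaring and cancelling 1 - c, what remains is c <= C^2 - S^2, that is cos t <= cos th. *)
rewrite -(@ler_pXn2r _ 2)// ?nnegrE// !exprMn sqrrN.
have -> : s ^+ 2 = (1 - c) * (1 + c) by lra.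
have -> : (1 - c) ^+ 2 = (1 - c) * (1 - c) by rewrite expr2.
rewrite mulrCA [leRHS]mulrCA ler_wpM2l//; first lra.
have S2 : S ^+ 2 = 1 - C ^+ 2 by lra.
rewrite S2 in cle *; lra.
Qed.

End Angles.

Section PlaneRotations.
Context {R : realType} {V : vectType R} (ip : {dot V for @idfun R}).
Variables e1 e2 : V.
Implicit Types (x y : V) (t s : R) (g h : 'End(V)).

(** For orthonormal e1, e2: rotation by t in their plane, identity on the orthogonal complement. *)
Definition rot_fun (t : R) x : V := x + (cos t - 1) *: (ip x e1 *: e1 + ip x e2 *: e2)
  + sin t *: (ip x e1 *: e2 - ip x e2 *: e1).

Lemma rot_fun_linear t : linear (rot_fun t).
Proof.
move=> k x y; apply: (ip_inj (ip := ip)) => z.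
by rewrite /rot_fun !(ipE ip); ring.
Qed.

HB.instance Definition _ t := GRing.isLinear.Build R V V *:%R (rot_fun t)
  (rot_fun_linear t).

Definition plane_rot t : 'End(V) := linfun (rot_fun t).

Lemma plane_rotE t x : plane_rot t x = x + (cos t - 1) *: (ip x e1 *: e1 + ip x e2 *: e2)
  + sin t *: (ip x e1 *: e2 - ip x e2 *: e1).
Proof. by rewrite lfunE. Qed.

Definition circ t : V := cos t *: e1 + sin t *: e2.

Definition plane_orthogonal x := ip x e1 = 0 /\ ip x e2 = 0.

Hypotheses (e11 : ip e1 e1 = 1) (e22 : ip e2 e2 = 1) (e12 : ip e1 e2 = 0).

Let e21 : ip e2 e1 = 0. Proof. by rewrite ipC. Qed.

Let ip_ee := (e11, e22, e12, e21).

Lemma circ0 : circ 0 = e1.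
Proof. by rewrite /circ cos0 sin0 scale1r scale0r addr0. Qed.

Lemma circ_pihalf : circ (pi / 2) = e2.
Proof. by rewrite /circ cos_pihalf sin_pihalf scale1r scale0r add0r. Qed.

Lemma ip_circ s t : ip (circ s) (circ t) = cos (s - t).
Proof. by rewrite /circ !(ipE ip) !ip_ee cosB; ring. Qed.

Lemma circ_unit t : ip (circ t) (circ t) = 1.
Proof. by rewrite ip_circ subrr cos0. Qed.

Lemma plane_orthogonal_circ x t : plane_orthogonal x -> ip x (circ t) = 0.
Proof. by move=> [x1 x2]; rewrite /circ !(ipE ip) x1 x2 !mulr0 addr0. Qed.

Lemma rot_fixed t x : plane_orthogonal x -> plane_rot t x = x.
Proof.
by move=> [x1 x2]; rewrite plane_rotE x1 x2 !scale0r subr0 addr0 !scaler0 !addr0.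
Qed.

Lemma rot_circ s t : plane_rot s (circ t) = circ (s + t).
Proof.
apply: (ip_inj (ip := ip)) => z.
by rewrite plane_rotE /circ !(ipE ip) !ip_ee sinD cosD; ring.
Qed.

Lemma plane_ext g h : g e1 = h e1 -> g e2 = h e2 ->
  (forall x, plane_orthogonal x -> g x = h x) -> g = h.
Proof.
move=> g1 g2 go; apply/lfunP => x.
pose y := x - (ip x e1 *: e1 + ip x e2 *: e2).
have yo : plane_orthogonal y by split; rewrite /y !(ipE ip) !ip_ee; ring.
rewrite -(subrK (ip x e1 *: e1 + ip x e2 *: e2) x) -/y.
by rewrite ![_ (y + _)]linearD /= go// ![_ (_ *: e1 + _)]linearD /=
  ![_ (_ *: e1)]linearZ ![_ (_ *: e2)]linearZ /= g1 g2.
Qed.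

Lemma circ_ext g h : (forall t, g (circ t) = h (circ t)) ->
  (forall x, plane_orthogonal x -> g x = h x) -> g = h.
Proof. by move=> gc go; apply: plane_ext => //; rewrite -?circ0 -?circ_pihalf gc. Qed.

Lemma plane_rot0 : plane_rot 0 = \1%VF.
Proof.
apply: circ_ext => [t|x xo]; first by rewrite rot_circ add0r lfunE.
by rewrite rot_fixed// lfunE.
Qed.

Lemma rot_comp s t : (plane_rot s \o plane_rot t)%VF = plane_rot (s + t).
Proof.
apply: circ_ext => [u|x xo]; rewrite lfunE /= ?rot_circ ?addrA//.
by rewrite !rot_fixed.
Qed.

Lemma refl_circ s d : refl ip (circ s) (circ (s - d)) = - circ (s + d).
Proof.
apply: (ip_inj (ip := ip)) => z.
rewrite reflE ip_circ (_ : s - d - s = - d); last by ring.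
by rewrite cosN /circ !(ipE ip) cosB sinB cosD sinD; ring.
Qed.

Lemma refl_circ_comp s u : (refl ip (circ s) \o refl ip (circ u))%VF = plane_rot (2 * (s - u)).
Proof.
apply: circ_ext => [t|x xo]; rewrite lfunE /=; last first.
  by rewrite !refl_fixed ?rot_fixed//; exact: plane_orthogonal_circ.
have -> : t = u - (u - t) by ring.
rewrite refl_circ linearN /=.
have -> : u + (u - t) = s - (s - 2 * u + t) by ring.
by rewrite refl_circ opprK rot_circ; congr circ; ring.
Qed.

Lemma det_rot t : lfun_det (plane_rot t) = 1.
Proof.
have -> : t = 2 * (t / 2 - 0) by rewrite subr0 mulrC divfK// pnatr_eq0.
by rewrite -refl_circ_comp lfun_det_comp !(det_refl (circ_unit _)) mulrNN mulr1.
Qed.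

Lemma rot_eq s t : cos s = cos t -> sin s = sin t -> plane_rot s = plane_rot t.
Proof. by move=> cc ss; apply/lfunP => x; rewrite !plane_rotE cc ss. Qed.

Lemma plane_decomposition y :
  (forall x, plane_orthogonal x -> ip y x = 0) -> y = ip y e1 *: e1 + ip y e2 *: e2.
Proof.
move=> yo; pose z := y - (ip y e1 *: e1 + ip y e2 *: e2).
have zo : plane_orthogonal z by split; rewrite /z !(ipE ip) !ip_ee; ring.
apply/eqP; rewrite -subr_eq0 -/z -(ip_eq0 ip).
have [z1 z2] := zo.
by rewrite {1}/z ipDl ipNl ipDl !ipZl yo// !(ipC ip _ z) z1 z2; apply/eqP; ring.
Qed.

Lemma orthogonal_det1_rot g : orthogonal_maps ip g -> lfun_det g = 1 ->
  (forall x, plane_orthogonal x -> g x = x) -> exists t, g = plane_rot t.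
Proof.
move=> og dg gfix.
have gdec y : (forall x, plane_orthogonal x -> ip y x = 0) ->
    g y = ip (g y) e1 *: e1 + ip (g y) e2 *: e2.
  by move=> yo; apply: plane_decomposition => x xo; rewrite -(gfix _ xo) og yo.
have g1E : g e1 = ip (g e1) e1 *: e1 + ip (g e1) e2 *: e2.
  by apply: gdec => x [xe1 _]; rewrite ipC.
have g2E : g e2 = ip (g e2) e1 *: e1 + ip (g e2) e2 *: e2.
  by apply: gdec => x [_ xe2]; rewrite ipC.
move: g1E g2E; move: (ip (g e1) e1) (ip (g e1) e2) (ip (g e2) e1) (ip (g e2) e2).
move=> c s u v g1E g2E.
have cs : c ^+ 2 + s ^+ 2 = 1 by rewrite -e11 -(og e1) g1E !(ipE ip) !ip_ee; ring.
have uv : u ^+ 2 + v ^+ 2 = 1 by rewrite -e22 -(og e2) g2E !(ipE ip) !ip_ee; ring.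
have csuv : c * u + s * v = 0 by rewrite -e12 -(og e1) g1E g2E !(ipE ip) !ip_ee; ring.
have [t [ct st]] := exists_angle cs; exists t.
(* k is the determinant of g on the plane; orthogonality makes the image of e2 equal to k times the
   image of e1 turned by pi / 2. *)
pose k := c * v - s * u.
have uE : u = - k * s.
  rewrite /k -[LHS]mulr1 -cs; apply/eqP; rewrite -subr_eq0; apply/eqP.
  transitivity (c * (c * u + s * v)); [ring|by rewrite csuv mulr0].
have vE : v = k * c.
  rewrite /k -[LHS]mulr1 -cs; apply/eqP; rewrite -subr_eq0; apply/eqP.
  transitivity (s * (c * u + s * v)); [ring|by rewrite csuv mulr0].
have : k ^+ 2 = 1.
  rewrite -[LHS]mulr1 -[X in _ * X = _]cs -uv uE vE; ring.
move/eqP; rewrite sqrf_eq1 => /orP[]/eqP k1.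
  apply: plane_ext => [||x xo]; last by rewrite gfix// rot_fixed.
    by rewrite -{2}circ0 rot_circ addr0 /circ ct st.
  rewrite -{2}circ_pihalf rot_circ /circ cosDpihalf sinDpihalf ct st g2E uE vE k1.
  by rewrite mulN1r mul1r.
(* For k = -1 the direction 0 goes to t, so the axis is at t / 2 and its normal at w. *)
pose w : R := t / 2 + pi / 2.
suff gE : g = refl ip (circ w).
  by move: dg; rewrite gE (det_refl (circ_unit _)) => /eqP; rewrite eqNr oner_eq0.
have e1E : e1 = circ (w - w) by rewrite subrr circ0.
have e2E : e2 = circ (w - t / 2) by rewrite /w addrAC subrr add0r circ_pihalf.
apply: plane_ext => [||x xo]; last first.
- by rewrite gfix// refl_fixed//; exact: plane_orthogonal_circ.
- rewrite [in RHS]e2E refl_circ (_ : w + t / 2 = t + pi / 2); last first.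
    by rewrite /w addrAC -splitr.
  by rewrite /circ cosDpihalf sinDpihalf ct st g2E uE vE k1 opprK mul1r
    mulN1r opprD !scaleNr opprK.
- rewrite [in RHS]e1E refl_circ (_ : w + w = t + pi); last first.
    by rewrite /w addrACA -!splitr.
  by rewrite /circ cosDpi sinDpi ct st g1E !scaleNr opprD !opprK.
Qed.

Lemma circ_dist s t : ip (circ s - circ t) (circ s - circ t) = 2 - 2 * cos (s - t).
Proof.
have sq u v : ip (u - v) (u - v) = ip u u + ip v v - 2 * ip u v.
  by rewrite !(ipE ip) (ipC ip v u); ring.
by rewrite sq !circ_unit ip_circ; ring.
Qed.

End PlaneRotations.

Lemma lfun_order_le {R : realType} {V : vectType R} (g : 'End(V)) (k : nat) :
  (0 < k)%N -> lfun_pow g k = \1%VF -> (lfun_order g <= k)%N.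
Proof.
move=> k0 gk; rewrite /lfun_order; case: xgetP => [m _ [_ _]|_]; last by [].
exact.
Qed.

(** * Rotations of a plane contained in a finite group *)

Section MinimalRotation.
Context {R : realType} {V : vectType R} (ip : {dot V for @idfun R}).
Variable W : set 'End(V).
Hypothesis W_group : orthogonal_subgroup ip W.
Hypothesis W_finite : finite_set W.
Variables e1 e2 : V.
Hypotheses (e11 : ip e1 e1 = 1) (e22 : ip e2 e2 = 1) (e12 : ip e1 e2 = 0).

Local Notation plane_rot := (plane_rot ip e1 e2).
Implicit Types s t th psi : R.

Lemma rot_group_add s t : W (plane_rot s) -> W (plane_rot t) -> W (plane_rot (s + t)).
Proof. by case: W_group => _ _ Wc _; rewrite -rot_comp//; exact: Wc. Qed.

Lemma rot_group_opp t : W (plane_rot t) -> W (plane_rot (- t)).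
Proof.
case: W_group => Wo _ _ Wv Wt; have lk := orthogonal_lker0 (Wo _ Wt).
suff -> : plane_rot (- t) = ((plane_rot t)^-1)%VF by exact: Wv.
by rewrite -[LHS](lker0_compKf lk) rot_comp// subrr plane_rot0// comp_lfun1r.
Qed.

Lemma rot_group_mulrn t k : W (plane_rot t) -> W (plane_rot (k%:R * t)).
Proof.
move=> Wt; elim: k => [|k IH]; first by rewrite mul0r plane_rot0//; case: W_group.
by rewrite -natr1 mulrDl mul1r; exact: rot_group_add.
Qed.

Lemma rot_pow t k : lfun_pow (plane_rot t) k = plane_rot (k%:R * t).
Proof.
elim: k => [|k IH]; first by rewrite mul0r plane_rot0.
by rewrite [LHS]/= -/(lfun_pow _ k) IH rot_comp// -natr1 mulrDl mul1r addrC.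
Qed.

(** Angles are defined only modulo 2 pi, so smallness is measured by the cosine, maximized over the
    nontrivial rotations in the finite W. *)
Lemma minimal_rotation psi : W (plane_rot psi) -> cos psi != 1 ->
  exists th, [/\ 0 < th <= pi, W (plane_rot th) &
    forall t, W (plane_rot t) -> cos t = 1 \/ cos t <= cos th].
Proof.
move=> Wpsi cpsi; pose G := [set g | W g /\ exists t, g = plane_rot t /\ cos t != 1].
have rot_cos t : ip (plane_rot t e1) e1 = cos t.
  have := rot_circ e11 e22 e12 t 0; rewrite circ0 addr0 => ->.
  by rewrite /circ ipDl !ipZl e11 (ipC ip e2) e12; ring.
have [||g0 [Wg [t0 [gE ct0]]] gmax] := @argmax_group _ _ G (fun g => ip (g e1) e1).
- by apply: sub_finite_set W_finite => g [].
- by exists (plane_rot psi); split=> //; exists psi.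
rewrite {}gE in Wg gmax; have cI : -1 <= cos t0 <= 1 by rewrite cos_geN1 cos_le1.
pose th := acos (cos t0).
have cth : cos th = cos t0 by rewrite acosK// in_itv.
exists th; split.
- by rewrite acos_gt0 ?acos_lepi// cos_geN1 lt_neqAle ct0 cos_le1.
(* [acos] forgets the sign of the angle; when it flips, th belongs to the inverse rotation. *)
- have : sin th ^+ 2 = sin t0 ^+ 2 by rewrite !sin2cos2 cth.
  move/eqP; rewrite eqf_sqr => /orP[]/eqP sth.
    by rewrite (rot_eq _ _ _ cth sth).
  rewrite (@rot_eq _ _ ip e1 e2 th (- t0)); first exact: rot_group_opp.
    by rewrite cosN.
  by rewrite sinN.
- move=> t Wt; have [->|ct] := eqVneq (cos t) 1; first by left.
  right; rewrite cth -!rot_cos; apply: gmax; split=> //; by exists t.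
Qed.

(** The remainder of t modulo th is the angle of a rotation in W and is smaller than th, hence
    zero. *)
Lemma rotation_multiple th t : 0 < th <= pi -> W (plane_rot th) ->
  (forall t, W (plane_rot t) -> cos t = 1 \/ cos t <= cos th) ->
  0 <= t -> W (plane_rot t) -> exists m : nat, t = m%:R * th.
Proof.
move=> /andP[th0 thpi] Wth thmin t0 Wt; pose q := Num.truncn (t / th).
exists q; pose rho := t - q%:R * th.
have Wrho : W (plane_rot rho).
  by apply: rot_group_add => //; apply: rot_group_opp; exact: rot_group_mulrn.
have /andP[q1 q2] := truncn_itv (divr_ge0 t0 (ltW th0)).
rewrite ler_pdivlMr// in q1; rewrite ltr_pdivrMr// -natr1 mulrDl mul1r in q2.
have rho0 : 0 <= rho by rewrite subr_ge0.
have rhoth : rho < th by rewrite ltrBlDl.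
apply/eqP; rewrite -subr_eq0 -/rho; apply/negPn/negP => rhon0.
have rhop : 0 < rho by rewrite lt_def rhon0.
have c1 : cos rho < 1 by rewrite -cos0 ltr_cos ?in_itv/=; lra.
have c2 : cos th < cos rho by rewrite ltr_cos ?in_itv/=; lra.
by case: (thmin _ Wrho) => ?; lra.
Qed.

(** Applied to 2 pi, [rotation_multiple] gives th = 2 pi / N; applied to psi, it shows that the N-th
    power of the rotation by psi is trivial. *)
Lemma minimal_rotation_angle psi : W (plane_rot psi) -> 0 <= psi -> cos psi != 1 ->
  exists N : nat, [/\ (lfun_order (plane_rot psi) <= N)%N, (1 < N)%N,
    W (plane_rot (pi *+ 2 / N%:R)) &
    forall t, W (plane_rot t) -> cos t = 1 \/ cos t <= cos (pi *+ 2 / N%:R)].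
Proof.
move=> Wpsi psi0 cpsi; have [th [th0 Wth thmin]] := minimal_rotation Wpsi cpsi.
have p0 := pi_gt0 R.
have r2pi : plane_rot (pi *+ 2) = \1%VF.
  by rewrite -(plane_rot0 e11 e22 e12); apply: rot_eq; rewrite ?cos2pi ?cos0 ?sin2pi ?sin0.
have [|N NE] := rotation_multiple (t := pi *+ 2) th0 Wth thmin (mulrn_wge0 _ (ltW p0)).
  by rewrite r2pi; case: W_group.
have [m mE] := rotation_multiple th0 Wth thmin psi0 Wpsi.
have N1 : (1 < N)%N.
  rewrite ltnNge; apply/negP => N1; have : N%:R <= 1 :> R by rewrite lern1.
  move: NE; rewrite mulr2n => NE NR.
  have : N%:R * th <= 1 * th by rewrite ler_wpM2r//; lra.
  by rewrite -NE mul1r => ?; lra.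
have N0 : N%:R != 0 :> R by rewrite pnatr_eq0; case: N N1 {NE}.
have thE : pi *+ 2 / N%:R = th by rewrite NE mulrAC divff// mul1r.
exists N; rewrite thE; split=> //.
apply: lfun_order_le; first by case: N N1 {NE N0 thE}.
rewrite rot_pow mE mulrCA -NE -(plane_rot0 e11 e22 e12); apply: rot_eq.
  by rewrite -[_ * _]add0r cosDpi_nat.
by rewrite -[_ * _]add0r sinDpi_nat.
Qed.

End MinimalRotation.

Section OrbitClasses.
Context {R : realType} {V : vectType R} (ip : {dot V for @idfun R}).
Variable W : set 'End(V).
Hypothesis W_group : orthogonal_subgroup ip W.
Implicit Types (x y p : V) (g h : 'End(V)).

Local Notation Wp := (alternating_subgroup W).

Lemma alternating_orthogonal_subgroup : orthogonal_subgroup ip Wp.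
Proof.
case: W_group => Wo W1 Wc Wv; split=> [g [/Wo]//||g h [Wg dg] [Wh dh]|g [Wg dg]].
- by split=> //; exact: lfun_det1.
- by split; [exact: Wc|rewrite -[LHS]/(lfun_det _) lfun_det_comp /lfun_det dg dh mulr1].
- split; first exact: Wv.
  have := lfun_detV (Wo _ Wg); rewrite /lfun_det dg mul1r; exact.
Qed.

Definition orbit_of x : orbit_space Wp :=
  exist _ (group_orbit Wp x) (ex_intro2 _ _ x I erefl).

Lemma orbit_of_act g x : Wp g -> orbit_of (g x) = orbit_of x.
Proof.
case: alternating_orthogonal_subgroup => Wo _ Wc Wv Wg.
apply: eq_exist; apply/seteqP; split=> _ [h Wh <-].
  by exists (h \o g)%VF; [exact: Wc|rewrite lfunE].
exists (h \o g^-1)%VF; first by apply: Wc => //; exact: Wv.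
by rewrite lfunE /= (orthogonalK (Wo _ Wg)).
Qed.

Lemma orbit_of_dist_le x y : orbit_dist ip (orbit_of x) (orbit_of y) <= ipdist ip x y.
Proof.
have [_ W1 _ _] := alternating_orthogonal_subgroup.
by apply: orbit_dist_le; exists \1%VF; rewrite ?lfunE.
Qed.

Lemma orbit_of_dist_ge x y m : (forall g, Wp g -> m <= ipdist ip x (g y)) ->
  m <= orbit_dist ip (orbit_of x) (orbit_of y).
Proof.
have [Wo W1 Wc Wv] := alternating_orthogonal_subgroup => hm.
apply: orbit_dist_ge => // _ _ [g Wg <-] [h Wh <-].
have og := Wo _ Wg; apply: le_trans (hm (g^-1 \o h)%VF _) _.
  by apply: Wc => //; exact: Wv.
rewrite /ipdist lfunE /= -(og (x - _)) linearB /= (orthogonalVK og).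
exact: lexx.
Qed.

Lemma orbit_of_surj (A : orbit_space Wp) : exists x, A = orbit_of x.
Proof. by have [x _ xA] := svalP A; exists x; case: A xA => A ? /= xA; exact: eq_exist. Qed.

End OrbitClasses.

(** * Circles around a cone point of the quotient *)

Section ConeLoops.
Context {R : realType} {V : vectType R} (ip : {dot V for @idfun R}).
Variable W : set 'End(V).
Hypothesis W_group : orthogonal_subgroup ip W.
Hypothesis W_finite : finite_set W.
Implicit Types (x y p : V) (g h : 'End(V)).

Local Notation Wp := (alternating_subgroup W).

(** p avoids the finitely many fixed spaces that do not contain U, so its stabilizer fixes U
    pointwise. *)
Lemma generic_fixed_point (U : {vspace V}) : exists2 p, p \in U &
  forall g, W g -> g p = p -> forall x, x \in U -> g x = x.
Proof.
have [sW sWE] := (finite_seqP W).1 W_finite.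
have [A|p pU pgen] := @vspace_avoid _ _ U
    [seq fixedSpace g | g <- sW & ~~ (U <= fixedSpace g)%VS].
  by case/mapP=> g; rewrite mem_filter => /andP[nU _] ->.
exists p => // g Wg gp x xU; apply/eqP/contraT => gx.
have pf : p \in fixedSpace g by apply/fixedSpaceP.
suff : p \notin fixedSpace g by rewrite pf.
apply: pgen; apply/mapP; exists g => //; rewrite mem_filter.
have -> : g \in sW by move: Wg; rewrite sWE.
rewrite andbT; apply/negP => /subvP/(_ x xU)/fixedSpaceP xg.
by move: gx; rewrite xg eqxx.
Qed.

Lemma orbit_gap p : exists2 e : R, 0 < e &
  forall g, W g -> g p <> p -> e <= ipnorm ip (p - g p).
Proof.
have [sW sWE] := (finite_seqP W).1 W_finite.
have [g|e e0 eP] := @pos_lower_bound R _ [seq g : 'End(V) <- sW | g p != p]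
    (fun g : 'End(V) => ipnorm ip (p - g p)).
  rewrite mem_filter => /andP[gp _]; rewrite lt_def ipnorm_ge0 andbT.
  by rewrite ipnorm_eq0 subr_eq0 eq_sym.
exists e => // g Wg /eqP gp; apply: eP; rewrite mem_filter gp.
by move: Wg; rewrite sWE.
Qed.

Section Plane.
Variables e1 e2 : V.
Hypotheses (e11 : ip e1 e1 = 1) (e22 : ip e2 e2 = 1) (e12 : ip e1 e2 = 0).
Local Notation rot := (plane_rot ip e1 e2).
Local Notation circ := (circ e1 e2).
Variables (N : nat) (N1 : (1 < N)%N).
Local Notation th := (pi *+ 2 / N%:R : R).
Hypothesis W_rot : W (rot th).
Hypothesis th_min : forall t, W (rot t) -> cos t = 1 \/ cos t <= cos th.

Let thE (c : R) : th / c = pi / (2 * N%:R) * (4 / c).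
Proof.
rewrite mulr2n; have N0 : N%:R != 0 :> R by rewrite pnatr_eq0; case: N N1.
have [->|c0] := eqVneq c 0; first by rewrite invr0 !mulr0.
by move: pi => p; field; rewrite N0 c0.
Qed.

Let half_angle (t : R) : 2 - 2 * cos (t *+ 2) = (2 * sin t) ^+ 2.
Proof. by rewrite cos_mulr2n cos2sin2 mulr2n; ring. Qed.

(** Elements of determinant 1 fixing p are rotations of the plane, with th as smallest angle; they
    make the circle around p a circle around a cone of angle th. Elements moving p are kept away by
    the choice of eps. *)
Lemma cone_loop : exists (eps : R) (z : nat -> nat -> orbit_space Wp),
  [/\ 0 < eps,
    forall r j, z r (j + 2 * 2 ^ r)%N = z r j,
    forall r j, 2 * eps * sin (pi / (2 * N%:R)) <=
      orbit_dist ip (z r j) (z r (j + 2 ^ r)%N) &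
    forall r j, orbit_dist ip (z r j) (z r j.+1) <=
      2 * eps * sin (pi / (2 * N%:R) / 2 ^+ r)].
Proof.
have p0 := pi_gt0 R; have NR : (0 : R) < N%:R by rewrite ltr0n ltnW.
pose U := (orthov ip <[e1]>%VS :&: orthov ip <[e2]>%VS)%VS.
have UP x : (x \in U) <-> plane_orthogonal ip e1 e2 x.
  rewrite memv_cap !mem_orthov1; split=> [/andP[/eqP ? /eqP ?]//|[x1 x2]].
  by apply/andP; split; apply/eqP.
have [p /UP pU pgen] := generic_fixed_point U.
(* An element moving p displaces it by at least 4 eps, so the image of the circle of radius eps
   stays at least 2 eps away from that circle. *)
have [d d0 gap] := orbit_gap p; pose eps := d / 4.
have eps0 : 0 < eps by rewrite divr_gt0.
pose pt t := p + eps *: circ t.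
(* One turn in the quotient is the angle th, cut into 2 * 2 ^ r steps. *)
pose ang (r j : nat) : R := j%:R * (th / (2 * 2 ^+ r)).
have rot_pt t : rot th (pt t) = pt (th + t).
  by rewrite /pt linearD /= [_ (eps *: _)]linearZ /= rot_circ// rot_fixed.
have ptB s t : pt s - pt t = eps *: (circ s - circ t).
  by rewrite /pt opprD addrACA subrr add0r scalerBr.
have normE s t : ipdist ip (pt s) (pt t) = eps * Num.sqrt (2 - 2 * cos (s - t)).
  rewrite /ipdist -/(ipnorm ip _) ptB ipnormZ (ger0_norm (ltW eps0)).
  by rewrite /ipnorm circ_dist.
have r2 r : 2 * 2 ^+ r != 0 :> R by rewrite mulf_neq0 ?expf_neq0.
have angD r j : ang r (j + 2 ^ r)%N = ang r j + th / 2.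
  have half (T c : R) : c != 0 -> c * (T / (2 * c)) = T / 2 by move=> c0; field.
  by rewrite /ang natrD mulrDl natrX half// expf_neq0.
set h := pi / (2 * N%:R) : R.
have h0 : 0 < h by rewrite divr_gt0 ?mulr_gt0.
have hpi : h <= pi / 4.
  rewrite /h ler_pM2l// lef_pV2 ?posrE ?mulr_gt0//.
  have : 2 <= N%:R :> R by rewrite ler_nat.
  by move=> ?; lra.
have sh0 : 0 <= sin h by apply: sin_ge0_pi; lra.
have th4 : th = h * 4 by rewrite -[LHS]divr1 thE divr1.
exists eps, (fun r j => orbit_of W (pt (ang r j))); split=> // r j.
- have -> : ang r (j + 2 * 2 ^ r)%N = th + ang r j.
    rewrite /ang natrD mulrDl addrC natrM natrX; congr (_ + _).
    by rewrite mulrC divfK.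
  by rewrite -rot_pt (orbit_of_act W_group)//; split=> //; exact: det_rot.
- apply: (orbit_of_dist_ge W_group) => g [Wg dg].
  have [Wo _ _ _] := W_group.
  have [gp|gp] := pselect (g p = p).
    have [t gE] : exists t, g = rot t.
      apply: orthogonal_det1_rot => //; first exact: Wo.
      by move=> x /UP; exact: pgen.
    have -> : g (pt (ang r (j + 2 ^ r)%N)) = pt (t + ang r (j + 2 ^ r)%N).
      by rewrite /pt linearD /= [_ (eps *: _)]linearZ /= gp gE rot_circ.
    rewrite normE -mulrA mulrCA ler_pM2l//.
    have -> : ang r j - (t + ang r (j + 2 ^ r)%N) = - (th / 2 + t).
      by rewrite angD; ring.
    rewrite cosN -[leLHS](ger0_norm _) ?mulr_ge0// -sqrtr_sqr ler_wsqrtr//.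
    rewrite -half_angle lerD2l lerN2 ler_pM2l//.
    have -> : h *+ 2 = th / 2 by rewrite th4 mulr2n; lra.
    apply: cos_half_shift_le; first by rewrite th4; lra.
    by apply: th_min; rewrite -gE.
  rewrite /ipdist -/(ipnorm ip _).
  have un t : ipnorm ip (eps *: circ t) = eps.
    by rewrite ipnormZ /ipnorm circ_unit// sqrtr1 mulr1 ger0_norm// ltW.
  have og := Wo _ Wg.
  have ung t : ipnorm ip (g (eps *: circ t)) = eps by rewrite -[RHS](un t) /ipnorm og.
  have := gap _ Wg gp.
  set s := ang r j; set t := ang r (j + 2 ^ r)%N.
  have -> : p - g p = (pt s - g (pt t)) + (g (eps *: circ t) - eps *: circ s).
    have alg (P Q S T : V) : P - Q = (P + S - (Q + T)) + (T - S).
      by rewrite opprD [P + S + _]addrACA -[T - S]opprB addrK.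
    by rewrite /pt [g (p + _)]linearD /= -alg.
  move=> le1; have le2 := ipnormD ip (pt s - g (pt t)) (g (eps *: circ t) - eps *: circ s).
  have le3 := ipnormD ip (g (eps *: circ t)) (- (eps *: circ s)).
  have unN : ipnorm ip (- (eps *: circ s)) = eps.
    by rewrite -scaleN1r ipnormZ normrN1 mul1r un.
  rewrite unN ung in le3.
  have dE : d = 4 * eps by rewrite /eps; lra.
  have : 2 * eps * sin h <= 2 * eps by rewrite ler_piMr ?sin_le1// mulr_ge0// ltW.
  by move=> ?; lra.
- apply: le_trans (orbit_of_dist_le W_group _ _) _.
  rewrite normE -mulrA mulrCA ler_pM2l//.
  have -> : ang r j - ang r j.+1 = - (h / 2 ^+ r *+ 2).
    have angS : ang r j.+1 = ang r j + th / (2 * 2 ^+ r).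
      by rewrite /ang -addn1 natrD [LHS]mulrDl mul1r.
    rewrite angS opprD addrA subrr add0r; congr (- _).
    rewrite th4 mulr2n; field; by rewrite expf_neq0.
  rewrite cosN half_angle sqrtr_sqr ger0_norm// mulr_ge0//.
  have k1 : 1 <= 2 ^+ r :> R by rewrite exprn_ege1// ler1n.
  have kp : 0 < 2 ^+ r :> R by lra.
  have hr0 : 0 <= h / 2 ^+ r by apply: ltW; exact: divr_gt0.
  apply: sin_ge0_pi; rewrite hr0 /= ler_pdivrMr//.
  have : pi <= pi * 2 ^+ r :> R by rewrite ler_peMr// ltW.
  by move=> ?; lra.
Qed.

End Plane.

End ConeLoops.

Lemma euclidean_distortion_ge {R : realType} {X : Type} (dX : X -> X -> R) (L : R) :
  (forall x x', 0 <= dX x x') -> (forall x, dX x x = 0) ->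
  (exists x x', 0 < dX x x') ->
  (forall (U : lmodType R) (ip : {dot U for @idfun R}) (f : X -> U) (a b : R), 0 < a ->
    (forall x x', a * dX x x' <= Num.sqrt (ip (f x - f x') (f x - f x'))) ->
    (forall x x', Num.sqrt (ip (f x - f x') (f x - f x')) <= b * dX x x') ->
    L <= b / a) ->
  (L%:E <= euclidean_distortion dX)%E.
Proof.
move=> dX_ge0 dXx dpos hL; rewrite /euclidean_distortion.
case: ifP => [/asboolP X1|_].
  by have [x [x']] := dpos; rewrite (X1 x x') dXx ltxx.
apply: le_ereal_inf_tmp => _ [H [ipH [ipHE [f ->]]]].
have normE u : `|u| = Num.sqrt (ipH u u) by rewrite ipHE sqrtr_sqr ger0_norm.
apply: distortion_ge => // a b a0 fa fb; apply: (hL H ipH f a b a0) => x x'.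
  by rewrite -normE.
by rewrite -normE.
Qed.

(** * Distortion bounds from pairs of reflections *)

Section LowerBound.
Context {R : realType} {V : vectType R} (ip : {dot V for @idfun R}).
Variable W : set 'End(V).
Hypothesis W_group : orthogonal_subgroup ip W.
Hypothesis W_finite : finite_set W.
Implicit Types (x y p a b : V) (g h : 'End(V)).

Local Notation Wp := (alternating_subgroup W).
Local Notation dist := (@orbit_dist R V ip Wp).

Lemma orbit_dist_ge0 (A B : orbit_space Wp) : 0 <= dist A B.
Proof.
apply: orbit_dist_ge => [|p q _ _]; last exact: ipdist_ge0.
by case: (alternating_orthogonal_subgroup W_group).
Qed.

Lemma orbit_dist_refl (A : orbit_space Wp) : dist A A = 0.
Proof.
apply/le_anti; rewrite orbit_dist_ge0 andbT; have [x ->] := orbit_of_surj A.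
apply: le_trans (orbit_of_dist_le W_group x x) _.
by rewrite /ipdist subrr ip0l sqrtr0.
Qed.

Lemma orbit_dist_gt0 (A B : orbit_space Wp) : A <> B -> 0 < dist A B.
Proof.
have [x ->] := orbit_of_surj A; have [y ->] := orbit_of_surj B => xy.
have [sW sWE] := (finite_seqP W).1 W_finite.
have [g|e e0 eP] := @pos_lower_bound R 'End(V) [seq g : 'End(V) <- sW | `[< Wp g >]]
    (fun g : 'End(V) => ipdist ip x (g y)).
  rewrite mem_filter => /andP[/asboolP Wg _]; rewrite lt_def ipdist_ge0 andbT.
  rewrite [ipdist _ _ _]/(ipnorm ip _) ipnorm_eq0 subr_eq0.
  by apply/eqP => xgy; apply: xy; rewrite xgy (orbit_of_act W_group).
apply: (lt_le_trans e0); apply: (orbit_of_dist_ge W_group) => g Wg.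
apply: eP; rewrite mem_filter; apply/andP; split; first exact/asboolP.
by case: Wg => + _; rewrite sWE.
Qed.

Lemma euclidean_distortion_ge1 : (1%:E <= euclidean_distortion dist)%E.
Proof.
have [X1|X1] := pselect (forall A B : orbit_space Wp, A = B).
  by rewrite /euclidean_distortion asboolT.
have [A [B AB]] : exists A B : orbit_space Wp, A <> B.
  apply: contrapT => h; apply: X1 => A B; apply: contrapT => AB.
  by apply: h; exists A, B.
have AB0 := orbit_dist_gt0 AB.
apply: euclidean_distortion_ge orbit_dist_ge0 orbit_dist_refl _ _.
  by exists A, B.
move=> U ipU f a b a0 fa fb; rewrite ler_pdivlMr// mul1r.
by have := le_trans (fa A B) (fb A B); rewrite ler_pM2r.
Qed.

Lemma reflection_pair_bound a b : ip a a = 1 -> ip b b = 1 ->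
  W (refl ip a) -> W (refl ip b) -> refl ip a <> refl ip b ->
  let n := lfun_order (refl ip a \o refl ip b)%VF in (0 < n)%N ->
  ((n%:R * sin (pi / (2 * n%:R)))%:E <= euclidean_distortion dist)%E.
Proof.
move=> a1 b1 Wa Wb ab n n0; pose w := b - ip a b *: a.
have wa : ip w a = 0 by rewrite /w ipDl ipNl ipZl a1 (ipC ip b); ring.
have wn0 : w != 0.
  apply/eqP => w0; have bE : b = ip a b *: a by apply/eqP; rewrite -subr_eq0 -/w w0.
  have : ip b b = ip a b ^+ 2 by rewrite {1 2}bE ipZl ipZr a1; ring.
  rewrite b1 => /esym/eqP; rewrite sqrf_eq1 => /orP[]/eqP c; apply: ab.
    by rewrite bE c scale1r.
  by rewrite bE c scaleN1r reflN.
have [k k0 e22] := normalize_vector ip wn0; set e2 := k *: w in e22.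
have e12 : ip a e2 = 0 by rewrite /e2 ipZr (ipC ip a) wa mulr0.
have bE : b = ip a b *: a + k^-1 *: e2.
  by rewrite /e2 scalerA mulVf ?gt_eqF// scale1r /w addrC subrK.
clearbody e2; have cs : ip a b ^+ 2 + k^-1 ^+ 2 = 1.
  rewrite -[RHS]b1 {2 3}bE !(ipE ip) a1 e12 (ipC ip e2) e12 e22; ring.
have [t [ct st]] := exists_angle cs.
have bt : b = circ a e2 t by rewrite /circ ct st.
have p0 := pi_gt0 R.
(* K full turns make the angle psi nonnegative, as [minimal_rotation_angle] requires. *)
pose K := Num.bound (2 * `|t| / (pi *+ 2)).
pose psi : R := 2 * (0 - t) + K%:R * (pi *+ 2).
have pi20 : 0 < pi *+ 2 :> R by rewrite pmulrn_lgt0.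
have psi0 : 0 <= psi.
  have : 2 * `|t| / (pi *+ 2) < K%:R by apply: archi_boundP; rewrite divr_ge0 ?mulr_ge0// ltW.
  rewrite ltr_pdivrMr// /psi => h; have := ler_norm t => ?; lra.
have rotE : (refl ip a \o refl ip b)%VF = plane_rot ip a e2 psi.
  rewrite bt -{1}(circ0 a e2) (refl_circ_comp a1 e22 e12).
  by apply: rot_eq; rewrite ?cosDpi_nat ?sinDpi_nat.
have Wpsi : W (plane_rot ip a e2 psi) by rewrite -rotE; case: W_group => _ _ Wc _; exact: Wc.
have cpsi : cos psi != 1.
  apply/eqP => c1; apply: ab; have s0 : sin psi = 0.
    by apply: cos1sin0; rewrite c1 normr1.
  have r1 : plane_rot ip a e2 psi = \1%VF.
    by rewrite -(plane_rot0 a1 e22 e12); apply: rot_eq; rewrite ?c1 ?s0 ?cos0 ?sin0.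
  rewrite -[LHS]comp_lfun1r -(refl_comp b1) comp_lfunA rotE r1.
  by rewrite comp_lfun1l.
have [N [nN N1 WN Nmin]] :=
  minimal_rotation_angle W_group W_finite a1 e22 e12 Wpsi psi0 cpsi.
have [eps [z [eps0 zper zdiam zstep]]] :=
  cone_loop W_group W_finite a1 e22 e12 N1 WN Nmin.
have N0 : (0 < N)%N by apply: ltnW.
have NR : (0 : R) < N%:R by rewrite ltr0n.
apply: (@le_trans _ _ (N%:R * sin (pi / (2 * N%:R)))%:E).
  by rewrite lee_fin; apply: mulr_sin_pi_le; rewrite n0 /n rotE.
apply: euclidean_distortion_ge orbit_dist_ge0 orbit_dist_refl _ _.
  exists (z 0 0)%N, (z 0 (0 + 2 ^ 0))%N; apply: lt_le_trans (zdiam 0 0)%N.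
  rewrite !mulr_gt0//; apply: sin_gt0_pi; rewrite divr_gt0 ?mulr_gt0//=.
  rewrite ltr_pdivrMr ?mulr_gt0// ltr_pMr//.
  have : 1 <= N%:R :> R by rewrite ler1n.
  by move=> ?; lra.
move=> U ipU f al be al0 fa fb.
exact: (lipschitz_loop_bound al0 eps0 N0 fa fb zper zdiam zstep).
Qed.

End LowerBound.

(** * Fundamental reflections and the Coxeter matrix *)

Lemma bigmaxn_ge (I : eqType) (s : seq I) (m : nat) (F : I -> nat) j : j \in s ->
  (F j <= \big[maxn/m]_(i <- s) F i)%N.
Proof.
elim: s => [//|i s IH]; rewrite inE big_cons leq_max => /predU1P[->|/IH ->].
  by rewrite leqnn.
by rewrite orbT.
Qed.

Lemma bigmaxn_attained (I : Type) (s : seq I) (m : nat) (F : I -> nat) :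
  \big[maxn/m]_(i <- s) F i = m \/ exists j, \big[maxn/m]_(i <- s) F i = F j.
Proof.
elim: s => [|i s IH]; first by left; rewrite big_nil.
rewrite big_cons; case: (leqP (F i) (\big[maxn/m]_(i <- s) F i)) => _; first exact: IH.
by right; exists i.
Qed.

Section OrderOfIsometries.
Context {R : realType} {V : vectType R} (ip : {dot V for @idfun R}).
Variable W : set 'End(V).
Hypothesis W_group : orthogonal_subgroup ip W.
Hypothesis W_finite : finite_set W.
Implicit Types g h : 'End(V).

Lemma lfun_powD g i j : lfun_pow g (i + j) = (lfun_pow g i \o lfun_pow g j)%VF.
Proof. by elim: i => [|i IH]; rewrite ?comp_lfun1l //= IH comp_lfunA. Qed.

Lemma lfun_pow_group g k : W g -> W (lfun_pow g k).
Proof.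
by case: W_group => _ W1 Wc _ Wg; elim: k => [//|k IH]; exact: Wc.
Qed.

(** Pigeonhole: two of the first size sW + 1 powers coincide, and the smaller one cancels. *)
Lemma lfun_finite_order g : W g -> exists2 k, (0 < k)%N & lfun_pow g k = \1%VF.
Proof.
move=> Wg; have [sW sWE] := (finite_seqP W).1 W_finite.
apply: contrapT => nok.
have inj : {in iota 0 (size sW).+1 &, injective (lfun_pow g)}.
  suff lt i j : (i < j)%N -> lfun_pow g i <> lfun_pow g j.
    by move=> i j _ _ e; case: (ltngtP i j) => // /lt; rewrite e.
  move=> ij e; apply: nok; exists (j - i)%N; first by rewrite subn_gt0.
  have [Wo _ _ _] := W_group; have lk := orthogonal_lker0 (Wo _ (lfun_pow_group i Wg)).
  have e' : lfun_pow g i = (lfun_pow g i \o lfun_pow g (j - i))%VF.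
    by rewrite -lfun_powD subnKC// ltnW.
  by rewrite -(lker0_compKf lk (lfun_pow g (j - i))) -e' lker0_compVf.
have := uniq_leq_size (s1 := map (lfun_pow g) (iota 0 (size sW).+1)) (s2 := sW).
rewrite map_inj_in_uniq// iota_uniq size_map size_iota ltnn => /(_ isT) h.
suff : false by []; apply: h => _ /mapP[k _ ->].
by have := lfun_pow_group k Wg; rewrite [X in X _ -> _]sWE.
Qed.

Lemma lfun_orderP g : W g ->
  (0 < lfun_order g)%N /\ lfun_pow g (lfun_order g) = \1%VF.
Proof.
move=> Wg; have [k0 k0p gk0] := lfun_finite_order Wg.
have ex : exists k, (0 < k)%N && `[< lfun_pow g k = \1%VF >].
  by exists k0; rewrite k0p; exact/asboolP.
rewrite /lfun_order; case: xgetP => [k _ []//|].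
case: (ex_minnP ex) => m /andP[m0 /asboolP gm] mmin /(_ m); case; split=> // j j0 gj.
by apply: mmin; rewrite j0; exact/asboolP.
Qed.

End OrderOfIsometries.

Section FundamentalReflections.
Context {R : realType} {V : vectType R} (ip : {dot V for @idfun R}).
Variable W : set 'End(V).
Implicit Types (a b c x y z p : V) (g h s t : 'End(V)).
Hypothesis W_group : orthogonal_subgroup ip W.
Hypothesis W_finite : finite_set W.
Variable x0 : V.
Hypothesis x0_regular : forall a, unit_root ip W a -> ip x0 a != 0.
Hypothesis W_generated : forall T, orthogonal_subgroup ip T ->
  (forall a, unit_root ip W a -> T (refl ip a)) -> W `<=` T.

Let C := [set y | forall s, W s -> reflection ip s -> same_side ip s x0 y].

Lemma in_chamber_weyl y : in_chamber ip W x0 y -> C y.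
Proof.
move=> yC s Ws rs a sa an0; have [b b1 sE] := reflection_refl rs.
rewrite sE in Ws sa; have rb : unit_root ip W b by [].
have aE : a = ip a b *: b.
  apply: (@scalerI _ _ 2); rewrite ?pnatr_eq0// scalerA.
  have := sa; rewrite reflE => /eqP; rewrite subr_eq addrC -subr_eq opprK => /eqP <-.
  by rewrite scaler_nat mulr2n.
have ab0 : ip a b != 0 by apply: contraNneq an0 => ab0; rewrite aE ab0 scale0r.
have -> : ip x0 a * ip y a = ip a b ^+ 2 * (ip x0 b * ip y b).
  by rewrite aE !ipZr !ipZl b1; ring.
have ab2 : 0 < ip a b ^+ 2 by rewrite lt_def sqr_ge0 sqrf_eq0 ab0.
rewrite pmulr_rgt0//; have [pb|pb] := posrootVN x0_regular rb.
  by rewrite mulr_gt0 ?yC//; case: pb.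
have := yC _ pb; have [_] := pb; rewrite !ipNr !oppr_gt0 => ? ?.
by rewrite nmulr_rgt0.
Qed.

(** Near the wall point p the mirror stays in the dominant cone, and a dominant z is a limit of the
    chamber points z + k x0. *)
Lemma wallroot_fundamental a : wallroot ip W x0 a ->
  fundamental_reflections ip W C (refl ip a).
Proof.
move=> [pa [p pa0 pb]]; have [[a1 Wa] _] := pa.
split=> //; first exact: refl_is_reflection.
exists p; first by rewrite refl_fixedP// pa0.
have [P PE] := posroots_seq ip W_finite x0.
have [b|e e0 eP] := @pos_lower_bound R V [seq b <- P | b != a] (fun b => ip p b).
  by rewrite mem_filter => /andP[/eqP ba /PE rb]; exact: pb.
exists e => // z; rewrite refl_fixedP// => /eqP za zp d d0.
have zb b : posroot ip W x0 b -> 0 <= ip z b.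
  move=> rb; have [->|ba] := eqVneq b a; first by rewrite za.
  have eb : e <= ip p b by apply: eP; rewrite mem_filter ba; exact/PE.
  have := ip_le_norm ip (p - z) b; have [[b1 _] _] := rb.
  rewrite {2}/ipnorm b1 sqrtr1 mulr1 ipnormB ipDl ipNl => le1.
  by move: zp; rewrite -[ipdist _ _ _]/(ipnorm ip (z - p)) => ?; lra.
have n0 := ipnorm_ge0 ip x0.
pose k := d / (ipnorm ip x0 + 1); have k0 : 0 < k by rewrite divr_gt0//; lra.
exists (z + k *: x0).
  apply: in_chamber_weyl => b rb; rewrite ipDl ipZl ltr_wpDl ?zb//.
  by rewrite mulr_gt0//; case: rb.
rewrite /ipdist -/(ipnorm ip _) addrAC subrr add0r ipnormZ (ger0_norm (ltW k0)).
rewrite /k mulrAC ltr_pdivrMr; last lra.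
by rewrite ltr_pM2l//; lra.
Qed.

Let fundamental_finite : finite_set (fundamental_reflections ip W C).
Proof. by apply: sub_finite_set W_finite => s []. Qed.

Lemma coxeter_entry_le s t : fundamental_reflections ip W C s ->
  fundamental_reflections ip W C t ->
  (lfun_order (s \o t)%VF <= max_coxeter_entry ip W C)%N.
Proof.
move=> fs ft; pose q := fundamental_seq ip W C.
have mem u : fundamental_reflections ip W C u -> u \in q.
  by move=> fu; rewrite /q /fundamental_seq in_fset_set// inE.
have si : (index s q < size q)%N by rewrite index_mem mem.
have ti : (index t q < size q)%N by rewrite index_mem mem.
rewrite /max_coxeter_entry.
apply: leq_trans (bigmaxn_ge _ _ (mem_index_enum (Ordinal si))).
apply: leq_trans (bigmaxn_ge _ _ (mem_index_enum (Ordinal ti))).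
by rewrite mxE /= !nth_index// mem.
Qed.

Lemma max_coxeter_entry_attained : max_coxeter_entry ip W C = 1%N \/
  exists s t, [/\ fundamental_reflections ip W C s, fundamental_reflections ip W C t &
    max_coxeter_entry ip W C = lfun_order (s \o t)%VF].
Proof.
rewrite /max_coxeter_entry.
have [->|[i ->]] := bigmaxn_attained (index_enum _) 1
  (fun i => \big[maxn/1%N]_j coxeter_matrix ip W C i j); first by left.
have [->|[j ->]] := bigmaxn_attained (index_enum _) 1
  (fun j => coxeter_matrix ip W C i j); first by left.
right; rewrite mxE; pose q := fundamental_seq ip W C.
have mem (k : 'I_(size q)) : fundamental_reflections ip W C q`_k.
  have : q`_k \in q by rewrite mem_nth.
  by rewrite {2}/q /fundamental_seq in_fset_set// inE.
by exists q`_i, q`_j; split.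
Qed.

Lemma max_coxeter_entry_gt0 : (0 < max_coxeter_entry ip W C)%N.
Proof.
have [->//|[s [t [[Ws _ _] [Wt _ _] ->]]]] := max_coxeter_entry_attained.
have [_ _ Wc _] := W_group.
by have [] := lfun_orderP W_group W_finite (Wc _ _ Ws Wt).
Qed.

Lemma involution_subgroup g : orthogonal_maps ip g -> (g \o g = \1)%VF ->
  orthogonal_subgroup ip [set \1%VF; g].
Proof.
move=> og gg; have o1 : orthogonal_maps ip (\1%VF : 'End(V)).
  by case: (orthogonal_subgroup_full ip).
have inv h : orthogonal_maps ip h -> (h \o h = \1)%VF -> (h^-1)%VF = h.
  by move=> /orthogonal_lker0 lk hh; rewrite -[RHS](lker0_compKf lk) hh comp_lfun1r.
split=> [h [->|->]//||h k [->|->] [->|->]|h [->|->]].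
- by left.
- by left; rewrite comp_lfun1l.
- by right; rewrite comp_lfun1l.
- by right; rewrite comp_lfun1r.
- by left.
- by left; rewrite inv// comp_lfun1l.
- by right; rewrite inv.
Qed.

(** W is its wall group; with at most one wall this lies in {1, r} for an r of square 1. *)
Lemma two_wallroots : (2 < #|` fset_set W|)%N ->
  exists a b, [/\ wallroot ip W x0 a, wallroot ip W x0 b & a <> b].
Proof.
move=> W2; apply: contrapT => one.
suff [r [or rr Wr]] : exists r : 'End(V), [/\ orthogonal_maps ip r, (r \o r = \1)%VF &
    forall a, wallroot ip W x0 a -> refl ip a = r].
  have sub : W `<=` [set \1%VF; r].
    rewrite (W_wall_group W_group W_finite x0_regular W_generated).
    apply: smallest_sub; first exact: involution_subgroup.
    by move=> _ [a wa <-]; right; exact: Wr.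
  have : (fset_set W `<=` [fset \1%VF; r])%fset.
    apply/fsubsetP => g; rewrite in_fset_set// inE => /sub.
    by rewrite !inE => -[->|->]; rewrite eqxx ?orbT.
  move/fsubset_leq_card/(leq_trans W2); rewrite cardfs2.
  by case: (_ != _).
have [[a wa]|now] := pselect (exists a, wallroot ip W x0 a).
  have [[[a1 _] _] _] := wa; exists (refl ip a); split.
  - exact: refl_orthogonal.
  - exact: refl_comp.
  - move=> b wb; congr refl; apply: contrapT => ba.
    by apply: one; exists a, b; split=> // /esym.
exists \1%VF; split; first by case: (orthogonal_subgroup_full ip).
  by rewrite comp_lfun1l.
by move=> a wa; case: now; exists a.
Qed.

Lemma wall_refl_neq a b : wallroot ip W x0 a -> wallroot ip W x0 b -> a <> b ->
  refl ip a <> refl ip b.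
Proof. by move=> [pa _] [pb _] ab /(posroot_refl_inj pa pb). Qed.

Lemma wall_pair_order_gt1 a b : wallroot ip W x0 a -> wallroot ip W x0 b -> a <> b ->
  (1 < lfun_order (refl ip a \o refl ip b)%VF)%N.
Proof.
move=> wa wb ab; have [[[a1 Wa] _] _] := wa; have [[[b1 Wb] _] _] := wb.
have [_ _ Wc _] := W_group.
have [k0] := lfun_orderP W_group W_finite (Wc _ _ Wa Wb).
rewrite ltn_neqAle k0 andbT; case: eqP => // <-; rewrite [LHS]comp_lfun1r => e.
case: (wall_refl_neq wa wb ab).
by rewrite -[LHS]comp_lfun1r -(refl_comp b1) comp_lfunA e comp_lfun1l.
Qed.

Lemma max_coxeter_entry_gt1 : (2 < #|` fset_set W|)%N ->
  (1 < max_coxeter_entry ip W C)%N.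
Proof.
move=> /two_wallroots[a [b [wa wb ab]]].
apply: leq_trans (wall_pair_order_gt1 wa wb ab) _.
by apply: coxeter_entry_le; exact: wallroot_fundamental.
Qed.

Lemma wall_pair_commute a b : (max_coxeter_entry ip W C <= 2)%N ->
  wallroot ip W x0 a -> wallroot ip W x0 b ->
  (refl ip a \o refl ip b = refl ip b \o refl ip a)%VF.
Proof.
move=> n2 wa wb; have [[[a1 Wa] _] _] := wa; have [[[b1 Wb] _] _] := wb.
have [_ _ Wc _] := W_group.
have le2 := leq_trans (coxeter_entry_le (wallroot_fundamental wa) (wallroot_fundamental wb)) n2.
have [k0 gk] := lfun_orderP W_group W_finite (Wc _ _ Wa Wb).
set g := (refl ip a \o refl ip b)%VF in le2 k0 gk *.
have gg : (g \o g = \1)%VF.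
  move: (lfun_order g) le2 k0 gk => [|[|[|k]]] //= _ _; rewrite comp_lfun1r //.
  by move=> ->; rewrite comp_lfun1l.
have : (refl ip b \o (refl ip a \o (g \o g)) = refl ip b \o refl ip a)%VF.
  by rewrite gg comp_lfun1r.
by rewrite /g !comp_lfunA -[(refl ip b \o refl ip a \o refl ip a)%VF]comp_lfunA
  refl_comp// comp_lfun1r refl_comp// comp_lfun1l.
Qed.

(** By commutation a and its image under the reflection in b have the same reflection; both are
    positive, hence equal. *)
Lemma wall_refl_fixes a b : (max_coxeter_entry ip W C <= 2)%N ->
  wallroot ip W x0 a -> wallroot ip W x0 b -> a <> b -> refl ip b a = a.
Proof.
move=> n2 wa wb ab; have [pa _] := wa; have [[[b1 Wb] _] _] := wb.
have [Wo _ _ _] := W_group.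
have pba := wallroot_permutes W_group x0_regular wb pa ab.
apply: (posroot_refl_inj pba pa).
rewrite -[LHS]comp_lfun1r -(refl_comp b1) comp_lfunA refl_conj; last exact: Wo.
by rewrite -(wall_pair_commute n2 wa wb) -comp_lfunA refl_comp// comp_lfun1r.
Qed.

(** If no entry exceeds 2, W is the product of the group of one wall reflection and the group of all
    the others. *)
Lemma max_coxeter_entry_gt2 : (2 < #|` fset_set W|)%N ->
  irreducible_reflection_group ip W -> (2 < max_coxeter_entry ip W C)%N.
Proof.
move=> /two_wallroots[a [b [wa wb ab]]] irr; rewrite ltnNge; apply/negP => n2.
apply: irr; have [Wo W1 Wc Wv] := W_group.
have [[[a1 Wa] _] _] := wa; have [[[b1 Wb] _] _] := wb.
pose S2 := [set refl ip c | c in [set c | wallroot ip W x0 c /\ c <> a]].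
pose G1 := smallest (orthogonal_subgroup ip) [set refl ip a].
pose G2 := smallest (orthogonal_subgroup ip) S2.
have unit c : wallroot ip W x0 c -> ip c c = 1 by case=> -[[]].
have S1o : [set refl ip a] `<=` orthogonal_maps ip.
  by move=> _ ->; exact: refl_orthogonal.
have S2o : S2 `<=` orthogonal_maps ip.
  by move=> _ [c [wc _] <-]; apply: refl_orthogonal; exact: unit.
have sG1 : orthogonal_subgroup ip G1 by exact: orthogonal_subgroup_smallest.
have sG2 : orthogonal_subgroup ip G2 by exact: orthogonal_subgroup_smallest.
have G1a : G1 (refl ip a) by move=> T [_]; apply.
have G2b : G2 (refl ip b) by move=> T [_]; apply; exists b => //; split=> // /esym.
have refl_neq1 c : ip c c = 1 -> refl ip c <> \1%VF.
  move=> c1 /(congr1 (fun g : 'End(V) => ip (g c) c)).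
  by rewrite refl_normal// lfunE /= ipNl c1 => /eqP; rewrite eqNr oner_eq0.
have G1E : G1 `<=` [set \1%VF; refl ip a].
  apply: smallest_sub; last by move=> _ ->; right.
  by apply: involution_subgroup; [exact: refl_orthogonal|exact: refl_comp].
have comm2 h : G2 h -> (refl ip a \o h = h \o refl ip a)%VF.
  pose T := [set h | orthogonal_maps ip h /\ (refl ip a \o h = h \o refl ip a)%VF].
  move=> G2h; suff [] : T h by [].
  move: h G2h; apply: smallest_sub; last first.
    move=> _ [c [wc _] <-]; split; first by apply: refl_orthogonal; exact: unit.
    exact: wall_pair_commute.
  have [_ O1 Oc Ov] := orthogonal_subgroup_full ip.
  split=> [h []//||g h [og cg] [oh ch]|h [oh ch]].
  - by split=> //; rewrite comp_lfun1l comp_lfun1r.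
  - by split; [exact: Oc|rewrite comp_lfunA cg -comp_lfunA ch comp_lfunA].
  - split; first exact: Ov.
    have lk := orthogonal_lker0 oh.
    by rewrite -[LHS](lker0_compKf lk) [X in (_ \o X)%VF]comp_lfunA -ch
      -comp_lfunA lker0_compfV// comp_lfun1r.
have comm g h : G1 g -> G2 h -> (g \o h = h \o g)%VF.
  move=> /G1E[->|->] G2h; last exact: comm2.
  by rewrite comp_lfun1l comp_lfun1r.
exists G1, G2; split=> //.
- split; last by move=> e; apply: (refl_neq1 a) => //; move: G1a; rewrite e.
  exists [set refl ip a] => // _ ->; exact: refl_is_reflection.
- split; last by move=> e; apply: (refl_neq1 b) => //; move: G2b; rewrite e.
  exists S2 => // _ [c [wc _] <-]; apply: refl_is_reflection; exact: unit.
- apply/seteqP; split=> [g [/G1E[//|->] G2a]|_ ->]; last first.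
    by split; [case: sG1|case: sG2].
  (* The other wall reflections fix a, hence so does every element of G2, whereas the reflection in
     a negates it. *)
  have : refl ip a a = a.
    pose T := [set h | orthogonal_maps ip h /\ h a = a].
    suff [] : T (refl ip a) by [].
    move: G2a; apply: smallest_sub; last first.
      move=> _ [c [wc ca] <-]; split; first by apply: refl_orthogonal; exact: unit.
      by apply: wall_refl_fixes => // /esym.
    have [_ O1 Oc Ov] := orthogonal_subgroup_full ip.
    split=> [h []//||g' h [og ga] [oh ha]|h [oh ha]].
    + by split=> //; rewrite lfunE.
    + by split; [exact: Oc|rewrite lfunE /= ha].
    + by split; [exact: Ov|rewrite -[in LHS]ha (orthogonalK oh)].
  rewrite refl_normal// => /(congr1 (ip a)) /eqP.
  by rewrite ipNr a1 eqNr oner_eq0.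
- have [_ G11 G1c G1v] := sG1; have [_ G21 G2c G2v] := sG2.
  have G1W : G1 `<=` W by apply: smallest_sub => // _ ->.
  have G2W : G2 `<=` W by apply: smallest_sub => // _ [c [[[[_ Wcc] _] _] _] <-].
  apply/seteqP; split; last first.
    by move=> _ [g /G1W Wg [h /G2W Wh <-]]; exact: Wc.
  rewrite {1}(W_wall_group W_group W_finite x0_regular W_generated).
  apply: smallest_sub; last first.
    move=> _ [c wc <-]; have [->|/eqP ca] := eqVneq c a.
      by exists (refl ip a) => //; exists \1%VF; rewrite ?comp_lfun1r.
    exists \1%VF => //; exists (refl ip c); rewrite ?comp_lfun1l// => T [_].
    by apply; exists c.
  split=> [_ [g /G1W Wg [h /G2W Wh <-]]||_ _ [g Gg [h Gh <-]] [g' Gg' [h' Gh' <-]]|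
      _ [g Gg [h Gh <-]]].
  + by apply: Wo; exact: Wc.
  + by exists \1%VF => //; exists \1%VF => //; rewrite comp_lfun1l.
  + exists (g \o g')%VF; first exact: G1c.
    exists (h \o h')%VF; first exact: G2c.
    by rewrite -!comp_lfunA; congr (_ \o _)%VF; rewrite !comp_lfunA (comm g' h).
  + exists (g^-1)%VF; first exact: G1v.
    exists (h^-1)%VF; first exact: G2v.
    have og : lker g == 0%VS by apply: orthogonal_lker0; apply: Wo; exact: G1W.
    have oh : lker h == 0%VS by apply: orthogonal_lker0; apply: Wo; exact: G2W.
    have ogh : lker (g \o h)%VF == 0%VS.
      by apply: orthogonal_lker0; apply: Wo; apply: Wc; [exact: G1W|exact: G2W].
    rewrite (comm _ _ (G1v _ Gg) (G2v _ Gh)) -[LHS](lker0_compKf ogh).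
    rewrite [((g \o h) \o _)%VF]comp_lfunA -[((g \o h) \o h^-1)%VF]comp_lfunA.
    by rewrite lker0_compfV// comp_lfun1r lker0_compfV// comp_lfun1r.
Qed.

End FundamentalReflections.

Theorem theorem22 (R : realType) (V : vectType R) (ip : {dot V for @idfun R})
    (W : set 'End(V)) (hW : finite_reflection_group ip W)
    (C : set V) (hC : weyl_chamber ip W C) :
  let n := max_coxeter_entry ip W C in
  let lb : R := n%:R * sin (pi / (2 * n%:R)) in
  [/\ (lb%:E <= euclidean_distortion
                  (@orbit_dist R V ip (alternating_subgroup W)))%E,
      (euclidean_distortion
         (@orbit_dist R V ip (alternating_subgroup W)) <= 2%:E)%E,
      (2 < #|` fset_set W|)%N -> Num.sqrt 2 <= lb
    & (2 < #|` fset_set W|)%N -> irreducible_reflection_group ip W ->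
      3 / 2 <= lb].
Proof.
case: hW => W_finite [S Srefl WE]; case: hC => x0 x0r CE.
have So : S `<=` orthogonal_maps ip by move=> s /Srefl[].
have W_group : orthogonal_subgroup ip W.
  by rewrite WE; exact: orthogonal_subgroup_smallest.
have x0_regular a : unit_root ip W a -> ip x0 a != 0.
  move=> [a1 Wa]; have := x0r _ Wa (refl_is_reflection a1).
  by rewrite refl_fixedP.
have W_generated T : orthogonal_subgroup ip T ->
    (forall a, unit_root ip W a -> T (refl ip a)) -> W `<=` T.
  move=> Tg Ta; rewrite WE; apply: smallest_sub => // s Ss.
  have [a a1 sE] := reflection_refl (Srefl _ Ss).
  by rewrite sE; apply: Ta; split=> //; rewrite -sE WE => T' [_]; apply.
have n0 : (0 < max_coxeter_entry ip W C)%N by rewrite CE; exact: max_coxeter_entry_gt0.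
move=> n lb; split.
(* At n = 1 the bound is sin (pi / 2) = 1, which includes the default value for trivial W; above 1
   the maximum comes from an actual pair of fundamental reflections. *)
- have [n1|n1] := leqP n 1.
    have nE : n = 1%N by apply/eqP; rewrite eqn_leq n1.
    rewrite /lb nE mul1r mulr1 sin_pihalf.
    exact: euclidean_distortion_ge1.
  have : n = 1%N \/ exists s t, [/\ fundamental_reflections ip W C s,
      fundamental_reflections ip W C t & n = lfun_order (s \o t)%VF].
    by rewrite /n CE; exact: max_coxeter_entry_attained.
  case=> [nE|[s [t [[Ws rs _] [Wt rt _] nE]]]]; first by rewrite nE in n1.
  have [a a1 sE] := reflection_refl rs; have [b b1 tE] := reflection_refl rt.
  rewrite {}sE {}tE in Ws Wt nE.
  rewrite /lb nE; apply: reflection_pair_bound => //; last by rewrite -nE.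
  move=> ab; move: n1; rewrite nE ltnNge; apply/negP; rewrite negbK.
  by apply: lfun_order_le => //; rewrite [LHS]comp_lfun1r ab refl_comp.
- exact: (euclidean_distortion_le2 W_group W_finite x0_regular W_generated).
- move=> W2; have n1 : (1 < n)%N by rewrite /n CE; exact: max_coxeter_entry_gt1.
  rewrite -sin_pi4; have := @mulr_sin_pi_le R 2 n; rewrite n1 /= => /(_ isT).
  by rewrite (_ : 2 * 2%:R = 4)//; rewrite -natrM.
- move=> W2 irr; have n1 : (2 < n)%N by rewrite /n CE; exact: max_coxeter_entry_gt2.
  have := @mulr_sin_pi_le R 3 n; rewrite n1 /= => /(_ isT).
  by rewrite (_ : 2 * 3%:R = 6) ?sin_pi6 ?mul1r//; rewrite -natrM.
Qed.
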